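(* Fix $0<q<1$ and $0<p<2$. 1. (Worst-case ideal risk.) $$\lim_{\eta\to0}\left[\frac{\sup_{G\in\mathcal G_p(\eta)}\tilde{\mathcal R}(T_q,G)}{\eta^p\log^{2-p}\log\frac1\eta}\right]=\begin{cases}1,&0<q\le\frac12,\\ \frac{q}{1-q},&\frac12<q<1.\end{cases}$$ 2. (Least favorable scale mixture.) Fix $0\le s\le1$. Set $\mu_b^*(\eta)=\log(\frac1\eta)/\log\log(\frac1\eta)$ and $\mu_v^*(\eta)=\log(\frac1\eta)\cdot\log\log(\frac1\eta)$, and define $\tilde\mu=\mu_b^*(\eta)$ if $0<q<\frac12$, $\tilde\mu=\mu_v^*(\eta)$ if $\frac12<q<1$, and $\tilde\mu=(1-s)\mu_b^*(\eta)+s\mu_v^*(\eta)$ if $q=\frac12$. For $\mu>1$ let $G_{\varepsilon,\mu}=(1-\varepsilon)E(\cdot)+\varepsilon E(\cdot/\mu)$ with $\varepsilon=\eta^p/\log^p(\mu)$. Then $$\lim_{\eta\to0}\left[\frac{\tilde{\mathcal R}(T_q,G_{\varepsilon,\tilde\mu})}{\sup_{G\in\mathcal G_p(\eta)}\tilde{\mathcal R}(T_q,G)}\right]=1.$$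
   Context: $E(t)=1-e^{-t}$ ($t\ge0$) is the standard exponential cdf, $\bar E=1-E$; for a cdf $G$, $\bar G=1-G$. $\mathcal F$ is the set of probability distributions on $[1,\infty)$; for $F\in\mathcal F$, $E\#F$ is the cdf $G(t)=\int E(t/\mu)\,dF(\mu)$, i.e. the law of $X$ when $\mu\sim F$ and $X\mid\mu\sim\mathrm{Exp}(\mu)$ (mean $\mu$). $\mathcal G_p(\eta)=\{E\#F:F\in\mathcal F,\ \int\log^p(\mu)\,dF(\mu)\le\eta^p\}$. FDR functional: $T_q(G)=\inf\{t:\bar G(t)\ge\frac1q\bar E(t)\}$ (with $\inf\emptyset=+\infty$). Ideal risk: for $G=E\#F$, $\tilde{\mathcal R}(T_q,G)=\mathbb{E}\big(\log\delta_{T_q(G)}(X)-\log\mu\big)^2$ where $\mu\sim F$, $X\mid\mu\sim\mathrm{Exp}(\mu)$, and $\delta_t(x)=x$ if $x\ge t$, $\delta_t(x)=1$ otherwise (for $t=+\infty$, $\delta_t\equiv1$). *)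

(* Defs.v *)
From HB Require Import structures.
From mathcomp Require Import all_boot all_order all_algebra.
From mathcomp Require Import all_classical all_reals all_analysis.
Set Implicit Arguments. Unset Strict Implicit. Unset Printing Implicit Defensive.
Import Order.TTheory GRing.Theory Num.Theory.
Import numFieldNormedType.Exports.
Local Open Scope classical_set_scope.
Local Open Scope ring_scope.

Section Defs.
Variable R : realType.

(* survival function of the standard exponential: bar E(t) = e^{-t} *)
Definition Ebar (t : R) : R := expR (- t).

(* bar G(t) for G = E#F : int bar E(t/mu) dF(mu) *)
Definition Gbar (F : set R -> \bar R) (t : R) : \bar R :=
  (\int[F]_(mu in [set: R]) (expR (- (t / mu)))%:E)%E.

(* FDR functional T_q(G) = inf { t >= 0 : bar G(t) >= bar E(t)/q }, inf of empty = +oo *)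
Definition Tq (q : R) (F : set R -> \bar R) : \bar R :=
  ereal_inf [set t%:E | t in [set t : R | 0 <= t /\ ((q^-1 * Ebar t)%:E <= Gbar F t)%E]].

Definition delta (T : \bar R) (x : R) : R := if (T <= x%:E)%E then x else 1.

(* E[(log delta_T(X) - log mu)^2 | mu],  X | mu ~ Exp with mean mu (density e^{-x/mu}/mu on [0,oo)) *)
Definition condrisk (T : \bar R) (mu : R) : \bar R :=
  (\int[@lebesgue_measure R]_(x in `[0%R, +oo[%classic)
      ((ln (delta T x) - ln mu) ^+ 2 * (mu^-1 * expR (- (x / mu))))%:E)%E.

Definition risk (q : R) (F : set R -> \bar R) : \bar R :=
  (\int[F]_(mu in [set: R]) condrisk (Tq q F) mu)%E.

Definition moment (p : R) (F : set R -> \bar R) : \bar R :=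
  (\int[F]_(mu in [set: R]) ((ln mu) `^ p)%:E)%E.

(* the mixing distributions F of G_p(eta): probabilities on [1,oo) with moment <= eta^p *)
Definition Gclass (p eta : R) : set (probability R R) :=
  [set F : probability R R | F [set x : R | x < 1] = 0%E /\
                             (moment p F <= (eta `^ p)%:E)%E].

Definition worst_risk (q p eta : R) : \bar R :=
  ereal_sup [set risk q (F : set R -> \bar R) | F in Gclass p eta].

Definition rate (p eta : R) : R := eta `^ p * (ln (ln eta^-1)) `^ (2 - p).

Definition Lconst (q : R) : R := if q <= 2^-1 then 1 else q / (1 - q).

Definition mu_b (eta : R) : R := ln eta^-1 / ln (ln eta^-1).
Definition mu_v (eta : R) : R := ln eta^-1 * ln (ln eta^-1).

Definition mu_tilde (q s eta : R) : R :=
  if q < 2^-1 then mu_b eta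
  else if 2^-1 < q then mu_v eta
  else (1 - s) * mu_b eta + s * mu_v eta.

Definition eps_of (p eta mu : R) : R := eta `^ p / (ln mu) `^ p.

(* mixing law of G_{eps,mu} = (1-eps) E + eps E(./mu): (1-eps) delta_1 + eps delta_mu *)
Definition mixture (eps mu : R) : set R -> \bar R :=
  fun A => ((1 - eps)%R%:E * \d_(1%R : R) A + eps%:E * \d_mu A)%E.

End Defs.

(* Main.v *)
(** Write [L = ln mu] and let [c = exp(- tau / mu)] be the chance that an observation of mean
    [mu] reaches the threshold [tau].  Given [mu], the risk is at most
    [L^2 (1 - c) + c (ln (1 + tau/mu) + O(1))^2]: a missed discovery costs [L^2], and a reported
    observation costs little unless [mu] is close to 1, where it costs about [ln^2 tau].

    The threshold satisfies [e^{-tau} / q <= E c].  Charging this constraint with the multiplier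
    [Q ln^2 tau], where [Q] tends to [q / (1 - q)], pays exactly for the reports with [mu] close
    to 1, and one is left with the pointwise inequality
    [L^2 (1 - c) + Q c ln^2 tau <= ((max 1 Q + o(1)) (ln tau)^{2-p} + O(1)) L^p], which holds
    because [c] switches from 0 to 1 around [L = ln tau].  Integrating yields the upper bound
    when [tau = O(ln (1/eta))]; for larger thresholds (and for [tau = +oo]) the fraction of
    non-null means is so small that the risk is only [O(eta^p)].

    For a two-point mixture [tau] is explicit and [e^{-tau} ~ eps c q / (1 - q)], so the risk is
    about [eps (L^2 (1 - c) + q / (1 - q) c ln^2 tau)] with both logarithms equivalent to
    [ln ln (1/eta)].  The choice of the mean makes [c] tend to 0 (bias) or 1 (variance), whichever
    is worse; at [q = 1/2] the two weights agree and [c] is irrelevant. *)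
Require Import Defs.
From HB Require Import structures.
From mathcomp Require Import all_boot all_order all_algebra.
From mathcomp Require Import all_classical all_reals all_analysis.
From mathcomp Require Import measurable_realfun ring lra.
Import Order.TTheory GRing.Theory Num.Theory.
Import numFieldNormedType.Exports.
Local Open Scope classical_set_scope.
Local Open Scope ring_scope.

(** * Comparison of integrals without measurability *)

Section comparison_of_integrals.
Local Open Scope ereal_scope.
Context d (T : measurableType d) (R : realType).
Variable mu : {measure set T -> \bar R}.
Implicit Types (D N : set T) (f g : T -> \bar R).

(* The integral of a nonnegative function is a supremum over simple functions, so it is monotone
   without any measurability; this is what lets [condrisk] be handled as a function of the mean. *)
Lemma le_integral_ge0 D f g : (forall x, D x -> 0 <= g x) -> (forall x, D x -> f x <= g x) ->
  \int[mu]_(x in D) f x <= \int[mu]_(x in D) g x.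
Proof.
move=> g0 fg; rewrite integralE.
apply: (@le_trans _ _ (\int[mu]_(x in D) f^\+ x)).
  by rewrite geeDl// oppe_le0; apply: integral_ge0.
rewrite !ge0_integralE//; apply: ge_ereal_sup => _ [h /= hf <-].
apply: ereal_sup_ubound; exists h => //= x; apply: le_trans (hf x) _.
rewrite /patch; case: ifPn => //; rewrite inE => Dx.
by rewrite funeposE ge_max fg ?g0.
Qed.

Lemma le_ge0_integral D f g : (forall x, D x -> 0 <= f x) -> (forall x, D x -> f x <= g x) ->
  \int[mu]_(x in D) f x <= \int[mu]_(x in D) g x.
Proof.
move=> f0 fg; apply: le_integral_ge0 => // x Dx.
exact: le_trans (f0 _ Dx) (fg _ Dx).
Qed.

(** Adding [+oo] on the null set [N] leaves the integral of [g] unchanged, and the sum dominates [f]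
    everywhere, so monotonicity applies. *)
Lemma le_integral_off_null N f g : measurable N -> mu N = 0 -> measurable_fun setT g ->
  (forall x, 0 <= g x) -> (forall x, ~ N x -> f x <= g x) ->
  \int[mu]_x f x <= \int[mu]_x g x.
Proof.
move=> mN N0 mg g0 fg.
pose h x := ((cst +oo : T -> \bar R) \_ N) x + g x.
have h0 x : 0 <= ((cst +oo : T -> \bar R) \_ N) x.
  by apply: erestrict_ge0 => ? _; exact: le0y.
apply: (@le_trans _ _ (\int[mu]_x h x)).
  apply: le_integral_ge0 => x _; first by rewrite /h adde_ge0.
  rewrite /h /patch; case: ifPn => [_|]; last by rewrite notin_setE add0e => /fg.
  by rewrite addye ?leey// gt_eqF// (lt_le_trans _ (g0 x))// ltNy0.
rewrite ge0_integralD//; last first.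
  by apply/(measurable_restrictT _ mN); exact: measurable_cst.
by rewrite -integral_mkcond integral_cst// N0 mule0 add0e.
Qed.

(** The sign of [f] on [N] is unknown: its negative part lives on [N], so it integrates to 0 by the
    previous lemma, and [g] cut off to the complement of [N] lies below the positive part of [f]. *)
Lemma ge_integral_off_null N f g : measurable N -> mu N = 0 -> measurable_fun setT g ->
  (forall x, 0 <= g x) -> (forall x, ~ N x -> g x <= f x) ->
  \int[mu]_x g x <= \int[mu]_x f x.
Proof.
move=> mN N0 mg g0 gf; rewrite [leRHS]integralE.
have -> : \int[mu]_x f^\- x = 0.
  apply/eqP; rewrite eq_le integral_ge0// andbT.
  have -> : 0 = \int[mu]_x (cst 0 : T -> \bar R) x by rewrite integral_cst// mul0e.
  apply: (le_integral_off_null N) => // x /gf gfx.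
  by rewrite funenegE ge_max lexx andbT oppe_le0 (le_trans (g0 x)).
rewrite sube0 (ge0_negligible_integral mN)// setTD.
rewrite integral_mkcond; apply: le_ge0_integral => x _.
  by rewrite /patch; case: ifP.
rewrite /patch; case: ifPn => [|_]; last by rewrite funeposE le_max lexx orbT.
rewrite inE => /gf h.
by rewrite funeposE le_max h.
Qed.

End comparison_of_integrals.

(** * Integrals of exponentials and of the squared logarithm *)

Section exponential_integrals.
Variable R : realType.
Local Notation leb := (@lebesgue_measure R).
Implicit Types b t m x : R.

Lemma is_derive_expR_affine b t x :
  is_derive x 1 (fun x => - expR (- ((x - t) * b))) (b * expR (- ((x - t) * b))).
Proof.
apply: is_derive_eq.
by rewrite /GRing.scale/= ?(subr0, addr0, mulr1, mul1r, scaler0, scale0r); ring.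
Qed.

Lemma continuous_expR_affine b t :
  continuous (fun x => b * expR (- ((x - t) * b)) : R).
Proof.
move=> x; apply: differentiable_continuous; apply/derivable1_diffP.
exact: ex_derive.
Qed.

Lemma measurable_expR_affine b t :
  measurable_fun [set: R] (EFin \o (fun x => b * expR (- ((x - t) * b)))).
Proof.
apply/measurable_EFinP; apply: continuous_measurable_fun.
exact: continuous_expR_affine.
Qed.

Lemma measurable_expR_scale b :
  measurable_fun [set: R] (EFin \o (fun x => b * expR (- (x * b)))).
Proof.
rewrite (_ : (fun x => _) = (fun x => b * expR (- ((x - 0) * b)))).
  exact: measurable_expR_affine.
by apply/funext => x; rewrite subr0.
Qed.

Lemma integral_expR_tail b t : 0 < b ->
  (\int[leb]_(x in `[t, +oo[) (b * expR (- ((x - t) * b)))%:E = 1%:E)%E.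
Proof.
move=> b0.
have dF x := is_derive_expR_affine b t x.
rewrite (@ge0_continuous_FTC2y _ _ (fun x => - expR (- ((x - t) * b))) _ 0).
- by rewrite subrr mul0r oppr0 expR0 -EFinB opprK add0r.
- by move=> x _; rewrite mulr_ge0 ?expR_ge0// ltW.
- by apply: continuous_subspaceT; exact: continuous_expR_affine.
- rewrite -oppr0; apply: cvgN.
  apply: (@cvg_comp _ _ _ (fun x => (x - t) * b) (fun y => expR (- y)) _ +oo%R);
    last exact: cvgr_expR.
  apply: gt0_cvgMly => //.
  by apply/cvgryPge => A; near=> x; rewrite lerBrDr; near: x; exact: nbhs_pinfty_ge.
- by move=> x _; exact: ex_derive.
- apply: cvg_at_right_filter.
  have : {for t, continuous (fun x => - expR (- ((x - t) * b)))}.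
    by apply: differentiable_continuous; apply/derivable1_diffP; exact: ex_derive.
  exact.
- by move=> x _; rewrite derive1E; exact: derive_val.
Unshelve. all: by end_near.
Qed.

Lemma integral_expR_head b t : 0 < t ->
  (\int[leb]_(x in `[0%R, t]) (b * expR (- (x * b)))%:E = (1 - expR (- (t * b)))%:E)%E.
Proof.
move=> t0.
have dF x := is_derive_expR_affine b 0 x.
have cF x : {for x, continuous (fun x => - expR (- ((x - 0) * b)))}.
  by apply: differentiable_continuous; apply/derivable1_diffP; exact: ex_derive.
under eq_integral do rewrite -[X in X * b]subr0.
rewrite (@continuous_FTC2 _ _ (fun x => - expR (- ((x - 0) * b))))//.
- by rewrite !subr0 mul0r oppr0 expR0 -EFinB opprK addrC.
- by apply: continuous_subspaceT; exact: continuous_expR_affine.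
- split.
  + by move=> x _; exact: ex_derive.
  + exact/cvg_at_right_filter/cF.
  + exact/cvg_at_left_filter/cF.
- by move=> x _; rewrite derive1E; exact: derive_val.
Qed.

Lemma is_derive_ln_div m x : 0 < m -> 0 < x ->
  is_derive x 1 (fun x => ln (x / m)) (m^-1 * (x / m)^-1).
Proof.
move=> m0 x0; have xm0 : 0 < x / m by rewrite divr_gt0.
have dg : is_derive x 1 (fun x : R => x / m) m^-1.
  by apply: is_derive_eq; rewrite /GRing.scale/= mulr0 add0r mulr1.
have := (@is_derive1_comp _ (@ln R) (fun x => x / m) x _ _ (is_derive1_ln xm0) dg).

by rewrite mulrC.
Qed.

(* [y * ((ln y - 1)^2 + 1)] is a nonnegative antiderivative of [ln^2 y]. *)
Lemma is_derive_ln_sqr_primitive m x : 0 < m -> 0 < x ->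
  is_derive x 1 (fun x => x / m * ((ln (x / m) - 1) ^+ 2 + 1)) (m^-1 * ln (x / m) ^+ 2).
Proof.
move=> m0 x0; have xm0 : 0 < x / m by rewrite divr_gt0.
have dh := is_derive_ln_div m x m0 x0.
apply: is_derive_eq; rewrite /GRing.scale/=.
by field; rewrite !gt_eqF.
Qed.

(** The primitive equals 2 at [m] and is nonnegative at [t], hence a bound uniform in [t]. *)
Lemma integral_ln_sqr_le2 t m : 0 < t < m ->
  (\int[leb]_(x in `[t, m]) (m^-1 * ln (x / m) ^+ 2)%:E <= 2%:E)%E.
Proof.
move=> /andP[t0 tm]; have m0 := lt_trans t0 tm.
have dF x : 0 < x -> is_derive x 1 _ _ := is_derive_ln_sqr_primitive m x m0.
have cF x : 0 < x ->
    {for x, continuous (fun x => x / m * ((ln (x / m) - 1) ^+ 2 + 1))}.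
  move=> /dF h; apply: differentiable_continuous; apply/derivable1_diffP.
  exact: ex_derive.
rewrite (@continuous_FTC2 _ _ (fun x => x / m * ((ln (x / m) - 1) ^+ 2 + 1)))//.
- rewrite divff ?gt_eqF// ln1 -EFinB lee_fin.
  have : 0 <= t / m * ((ln (t / m) - 1) ^+ 2 + 1).
    by rewrite mulr_ge0 ?addr_ge0 ?sqr_ge0 ?divr_ge0// ltW.
  set z := (_ / _ * _); lra.
- apply: continuous_in_subspaceT => x; rewrite inE/= in_itv/= => /andP[tx _].
  have x0 : 0 < x by exact: lt_le_trans tx.
  have dh := is_derive_ln_div m x m0 x0.
  by apply: differentiable_continuous; apply/derivable1_diffP; exact: ex_derive.
- split.
  + by move=> x /[!in_itv]/= /andP[tx _]; have := dF _ (lt_trans t0 tx) => h; exact: ex_derive.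
  + exact/cvg_at_right_filter/cF.
  + exact/cvg_at_left_filter/cF.
- move=> x /[!in_itv]/= /andP[tx _]; have := dF _ (lt_trans t0 tx) => h.
  by rewrite derive1E; exact: derive_val.
Qed.

End exponential_integrals.

(** * Risk given the mean *)

Section conditional_risk.
Variable R : realType.
Local Notation leb := (@lebesgue_measure R).
Implicit Types (b t m x : R) (T : \bar R).

Lemma condrisk_ge0 T m : 0 < m -> (0 <= condrisk T m)%E.
Proof.
move=> m0; apply: integral_ge0 => x _.
by rewrite lee_fin mulr_ge0 ?sqr_ge0// mulr_ge0 ?expR_ge0// invr_ge0 ltW.
Qed.

(** Only the observations below [t] are kept; there the estimate is 1 and the loss is [ln m ^+ 2].
    The interval is open at [t], where the observation is already reported. *)
Lemma condrisk_ge_bias t m : 0 < t -> 0 < m ->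
  ((ln m ^+ 2 * (1 - expR (- (t / m))))%:E <= condrisk t%:E m)%E.
Proof.
move=> t0 m0.
have mf : measurable_fun [set: R] (EFin \o (fun x : R => m^-1 * expR (- (x * m^-1)))).
  exact: measurable_expR_scale.
rewrite EFinM -integral_expR_head// -integral_itv_bndo_bndc; last exact: measurable_funTS.
rewrite -ge0_integralZl//=; last 3 first.
- exact: measurable_funTS.
- by move=> x _; rewrite lee_fin mulr_ge0 ?expR_ge0// invr_ge0 ltW.
- by rewrite lee_fin sqr_ge0.
rewrite /condrisk integral_mkcond [leRHS]integral_mkcond.
apply: le_ge0_integral => x _.
  rewrite /patch; case: ifPn => // _.
  by rewrite -EFinM lee_fin mulr_ge0 ?sqr_ge0// mulr_ge0 ?expR_ge0// invr_ge0 ltW.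
rewrite /patch; case: ifPn => [|_]; last first.
  case: ifPn => // _.
  by rewrite lee_fin mulr_ge0 ?sqr_ge0// mulr_ge0 ?expR_ge0// invr_ge0 ltW.
rewrite inE/= in_itv/= => /andP[x0 xt].
rewrite ifT; last by rewrite inE/= in_itv/= x0.
rewrite /delta ifF; last by apply/negbTE; rewrite lee_fin -ltNge.
by rewrite ln1 sub0r sqrrN EFinM.
Qed.

Lemma condrisk1_ge_variance t : 1 <= t ->
  ((ln t ^+ 2 * expR (- t))%:E <= condrisk t%:E 1)%E.
Proof.
move=> t1.
have mf : measurable_fun [set: R] (EFin \o (fun x : R => 1 * expR (- ((x - t) * 1)))).
  exact: measurable_expR_affine.
rewrite -[leLHS]mule1 -(integral_expR_tail _ _ t ltr01).
rewrite -ge0_integralZl//=; last 2 first.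
- exact: measurable_funTS.
- by rewrite lee_fin mulr_ge0 ?sqr_ge0 ?expR_ge0.
rewrite /condrisk integral_mkcond [leRHS]integral_mkcond.
apply: le_ge0_integral => x _.
  rewrite /patch; case: ifPn => // _.
  by apply: mule_ge0; rewrite lee_fin mulr_ge0 ?sqr_ge0 ?expR_ge0.
rewrite /patch; case: ifPn => [|_]; last first.
  case: ifPn => // _.
  by rewrite lee_fin mulr_ge0 ?sqr_ge0// mulr_ge0 ?expR_ge0// invr_ge0.
rewrite inE/= in_itv/= andbT => tx.
have x1 := le_trans t1 tx.
rewrite ifT; last by rewrite inE/= in_itv/= andbT (le_trans ler01).
rewrite /delta ifT; last by rewrite lee_fin.
rewrite ln1 subr0 ?invr1 ?mul1r ?mulr1 ?mul1r -EFinM lee_fin -mulrA -expRD.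
rewrite (_ : - t + _ = - x); last by ring.
rewrite ler_wpM2r ?expR_ge0// ler_sqr ?nnegrE ?ln_ge0//.
by rewrite ler_ln ?posrE// (lt_le_trans ltr01).
Qed.

(** From [u + w <= (1 + u) (1 + w) <= (1 + u) exp w]. It separates the level [u] of the threshold
    from the excess [w] over it. *)
Lemma ln_le_ln1D u w : 0 <= u -> 0 <= w -> 0 < u + w :> R -> ln (u + w) <= ln (1 + u) + w.
Proof.
move=> u0 w0 uw0.
have u1 : 0 < 1 + u by lra.
rewrite -[w in leRHS]expRK -lnM ?posrE ?expR_gt0// ler_ln ?posrE ?mulr_gt0 ?expR_gt0//.
have : (1 + u) * (1 + w) <= (1 + u) * expR w by rewrite ler_wpM2l ?expR_ge1Dx// ltW.
by apply: le_trans; nra.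
Qed.

(* The tail [ln^2(x/m)] is dominated by [K^2 exp(2w/K)] with [w = (x-t)/m], which keeps the
   integral exponential while costing only [O(K)] relative to the sharp value [K^2]. *)
Lemma condrisk_le t m : 0 < t -> 0 < m ->
  (condrisk t%:E m <= (ln m ^+ 2 * (1 - expR (- (t / m))) +
     expR (- (t / m)) * (ln (1 + t / m) + 8) ^+ 2)%:E)%E.
Proof.
move=> t0 m0.
set u := t / m; have u0 : 0 < u by rewrite divr_gt0.
set c := ln (1 + u); have c0 : 0 <= c by rewrite ln_ge0//; lra.
pose b := m^-1; have b0 : 0 < b by rewrite invr_gt0.
pose K := c + 4; have K4 : 4 <= K by rewrite /K; lra.
(* The factor [exp(2w/K)] lowers the decay rate from 1 to [k], which is at least 1/2 since
   [K >= 4]. *)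
pose k := 1 - 2 / K.
have K0 : 0 < K by lra.
have k0 : 0 < k by rewrite /k subr_gt0 ltr_pdivrMr; lra.
have kb0 : 0 < k * b by rewrite mulr_gt0.
pose A := K ^+ 2 * expR (- u) / k.
have A0 : 0 <= A by rewrite /A !mulr_ge0 ?invr_ge0 ?expR_ge0 ?sqr_ge0// ltW.
(* [f1] bounds the integrand below [t], [f2] on reports above the mean, and [f3] on reports below
   the mean, which exist only if [t < m]; there [ln (x / m)] is negative. *)
pose f1 := fun x : R => ((ln m ^+ 2)%:E * (b * expR (- (x * b)))%:E)%E.
pose f2 := fun x : R => (A%:E * ((k * b) * expR (- ((x - t) * (k * b))))%:E)%E.
pose f3 := fun x : R => ((b * ln (x / m) ^+ 2)%:E)%E.
have f10 x : (0 <= f1 x)%E.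
  by rewrite /f1 -EFinM lee_fin mulr_ge0 ?sqr_ge0// mulr_ge0 ?expR_ge0// ltW.
have f20 x : (0 <= f2 x)%E.
  by rewrite /f2 -EFinM lee_fin mulr_ge0// mulr_ge0 ?expR_ge0// ltW.
have f30 x : (0 <= f3 x)%E by rewrite /f3 lee_fin mulr_ge0 ?sqr_ge0// ltW.
have mg1 : measurable_fun [set: R] (EFin \o (fun x : R => b * expR (- (x * b)))).
  exact: measurable_expR_scale.
have mg2 : measurable_fun [set: R] (EFin \o (fun x : R => (k * b) * expR (- ((x - t) * (k * b))))).
  exact: measurable_expR_affine.
have mf1 : measurable_fun setT f1 by exact: measurable_funeM.
have mf2 : measurable_fun setT f2 by exact: measurable_funeM.
have mf3 : measurable_fun setT f3.
  apply/measurable_EFinP; apply: measurable_funM => //; apply: measurable_funX.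
  apply: measurableT_comp; first exact: measurable_ln.
  exact: measurable_funM.
have I1 : (\int[leb]_(x in `[0%R, t]) f1 x = (ln m ^+ 2 * (1 - expR (- u)))%:E)%E.
  rewrite ge0_integralZl//; last 3 first.
  - exact: measurable_funTS.
  - by move=> x _; rewrite lee_fin mulr_ge0 ?expR_ge0// ltW.
  - by rewrite lee_fin sqr_ge0.
  by rewrite integral_expR_head.
have I2 : (\int[leb]_(x in `[t, +oo[) f2 x = A%:E)%E.
  rewrite ge0_integralZl//; last 2 first.
  - exact: measurable_funTS.
  - by move=> x _; rewrite lee_fin mulr_ge0 ?expR_ge0// ltW.
  by rewrite integral_expR_tail ?mule1.
have I3 : (\int[leb]_(x in `[t, m[) f3 x <= (8 * expR (- u))%:E)%E.
  have [tm|mt] := ltP t m; last first.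
    by rewrite set_itv_ge ?integral_set0 ?lee_fin ?mulr_ge0 ?expR_ge0// bnd_simp -leNgt.
  rewrite integral_itv_bndo_bndc; last exact: measurable_funTS.
  apply: (le_trans (integral_ln_sqr_le2 _ t m _)); first by rewrite t0.
  rewrite lee_fin.
  (* Since [u < 1], [exp(-u) >= exp(-1) >= 1/4], so the bound 2 is at most [8 exp(-u)]. *)
  have u1 : u < 1 by rewrite /u ltr_pdivrMr// mul1r.
  have : 1 + - 1 / 2 <= expR (- 1 / 2 : R) by exact: expR_ge1Dx.
  have e1 : expR (- 1 / 2) * expR (- 1 / 2) = expR (-1) :> R.
    by rewrite -expRD; congr expR; lra.
  have e2 : expR (-1) <= expR (- u) by rewrite ler_expR; lra.
  nra.
rewrite /condrisk.
apply: (@le_trans _ _ (\int[leb]_x ((f1 \_ `[0%R, t]) x + ((f2 \_ `[t, +oo[) x + (f3 \_ `[t, m[) x)))%E); last first.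
  have P0 f D : (forall x, (0 <= f x)%E) -> forall x : R, (0 <= (f \_ D) x)%E.
    by move=> f0 x; rewrite /patch; case: ifP.
  have mP f D : measurable D -> measurable_fun setT f ->
      measurable_fun setT ((f : R -> \bar R) \_ D).
    by move=> mD mf; apply/(measurable_restrictT _ mD); exact: measurable_funTS.
  rewrite ge0_integralD//; last 4 first.
  - by move=> x _; exact: P0.
  - exact: mP.
  - by move=> x _; apply: adde_ge0; exact: P0.
  - by apply: emeasurable_funD; exact: mP.
  rewrite ge0_integralD//; last 4 first.
  - by move=> x _; exact: P0.
  - exact: mP.
  - by move=> x _; exact: P0.
  - exact: mP.
  rewrite -!integral_mkcond I1 I2.
  apply: (@le_trans _ _ ((ln m ^+ 2 * (1 - expR (- u)))%:E + (A%:E + (8 * expR (- u))%:E))%E).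
    by rewrite !leeD2l.
  rewrite -!EFinD lee_fin lerD2l /A.
  (* What remains is [K^2 / k + 8 <= (K + 4)^2], where [K + 4 = c + 8]; this is where the 8 of the
     statement comes from. *)
  rewrite [leLHS](_ : _ = expR (- u) * (K ^+ 2 / k + 8)); last by ring.
  rewrite ler_wpM2l ?expR_ge0//.
  have -> : K ^+ 2 / k = K ^+ 3 / (K - 2).
    by rewrite /k; field; rewrite !gt_eqF//; lra.
  rewrite -lerBrDr ler_pdivrMr; last lra.
  rewrite /K; nra.
rewrite integral_mkcond; apply: le_ge0_integral => x _.
  rewrite /patch; case: ifPn => // _.
  by rewrite lee_fin mulr_ge0 ?sqr_ge0// mulr_ge0 ?expR_ge0// invr_ge0 ltW.
rewrite {1}/patch; case: ifPn => [|_]; last first.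
  by rewrite !adde_ge0// /patch; case: ifP.
rewrite inE/= in_itv/= andbT => x0.
rewrite /delta lee_fin; case: ifPn => [tx|]; last first.
  rewrite -ltNge => xt.
  rewrite [leRHS](_ : _ = f1 x); last first.
    rewrite /patch ifT; last by rewrite inE/= in_itv/= x0 ltW.
    rewrite memNset ?memNset ?adde0//=; rewrite in_itv/=; apply/negP;
      by rewrite negb_and -ltNge xt.
  by rewrite /f1 ln1 sub0r sqrrN.
have xp : 0 < x by exact: lt_le_trans tx.
rewrite -ln_div ?posrE//.
apply: (@le_trans _ _ ((f2 \_ `[t, +oo[) x + (f3 \_ `[t, m[) x)%E); last first.
  by rewrite leeDr// /patch; case: ifP.
have -> : (f2 \_ `[t, +oo[) x = f2 x.
  by rewrite /patch ifT// inE/= in_itv/= tx.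
have [xm|mx] := ltP x m.
  have -> : (f3 \_ `[t, m[) x = f3 x by rewrite /patch ifT// inE/= in_itv/= tx.
  rewrite (le_trans _ (leeDr _ _))// /f3 lee_fin -/b mulrCA ler_wpM2l ?(ltW b0)//.
  by rewrite -[leRHS]mulr1 ler_wpM2l ?sqr_ge0// expR_le1 oppr_le0 mulr_ge0// ltW.
rewrite (le_trans _ (leeDl _ _))//; last by rewrite /patch; case: ifP.
rewrite /f2 -EFinM lee_fin -/b /A.
pose w := (x - t) * b.
have w0 : 0 <= w by rewrite mulr_ge0 ?subr_ge0 ?(ltW b0).
have xE : x / m = u + w by rewrite /w /u /b; ring.
rewrite (_ : _ * (k * b * _) = K ^+ 2 * expR (2 * (w / K)) * (b * expR (- (x / m)))); last first.
  have -> : expR (- (x / m)) = expR (- u) * expR (- w) by rewrite xE opprD expRD.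
  have -> : expR (- ((x - t) * (k * b))) = expR (- w) * expR (2 * (w / K)).
    by rewrite -expRD; congr expR; rewrite /w /k; ring.
  by field; rewrite gt_eqF.
rewrite ler_wpM2r//; first by rewrite mulr_ge0 ?expR_ge0 ?ltW.
have l0 : 0 <= ln (x / m) by rewrite ln_ge0// ler_pdivlMr ?mul1r.
have l1 : ln (x / m) <= K * expR (w / K).
  apply: (@le_trans _ _ (c + w)).
    by rewrite xE ln_le_ln1D// ?(ltW u0)// -xE divr_gt0.
  apply: (@le_trans _ _ (K * (1 + w / K))).
    rewrite mulrDr mulr1 mulrCA divff ?gt_eqF// mulr1 /K; lra.
  by rewrite ler_wpM2l ?expR_ge1Dx// ltW.
rewrite [leRHS](_ : _ = (K * expR (w / K)) ^+ 2); last first.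
  by rewrite exprMn expRM_natl.
by rewrite ler_sqr ?nnegrE// (le_trans l0).
Qed.

End conditional_risk.

(** * Pointwise inequalities *)

Section pointwise_bounds.
Variable R : realType.
Implicit Types (a k p q t u x L M : R).

Lemma expR_ge_pow x n : 0 <= x -> x ^+ n.+1 / n.+1`!%:R <= expR x.
Proof. by move=> x0; apply: le_trans (expR_ge1Dxn n x0); rewrite lerDr. Qed.

Lemma sqr_powR_split p x : 0 <= x -> x ^+ 2 = x `^ p * x `^ (2 - p).
Proof.
move=> x0; rewrite -powRD; last by rewrite addrC subrK pnatr_eq0.
by rewrite addrC subrK -powR_mulrn.
Qed.

Lemma powR_ge1 p x : 0 <= p -> 1 <= x -> 1 <= x `^ p.
Proof. by move=> p0 x1; rewrite -(powRr0 x) ler_powR. Qed.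

Lemma powR_le_sqr p x : p <= 2 -> 1 <= x -> x `^ p <= x ^+ 2.
Proof.
move=> p2 x1; rewrite -powR_mulrn ?ler_powR//; exact: le_trans x1.
Qed.

(** As [a >= 1] and [p <= 2], the factor [a^p] is enlarged to [a^2]; later error factors are then
    polynomial and serve both exponents [p] and [2 - p]. *)
Lemma powR_le_sqr_mul a p x M : 0 <= p <= 2 -> 1 <= a -> 0 <= M -> 0 <= x ->
  x <= a * M -> x `^ p <= a ^+ 2 * M `^ p.
Proof.
move=> /andP[p0 p2] a1 M0 x0 xaM.
have a0 : 0 <= a by exact: le_trans a1.
apply: (@le_trans _ _ ((a * M) `^ p)).
  by rewrite ge0_ler_powR// ?nnegrE// mulr_ge0.
by rewrite powRM// ler_wpM2r ?powR_ge0// powR_le_sqr.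
Qed.

(** A stand-in for [ln t] that stays at least 8 for all positive [t]; the 8 is that of
    [condrisk_le]. *)
Definition Mlog t : R := ln (1 + t) + 8.

Lemma Mlog_ge8 t : 0 < t -> 8 <= Mlog t.
Proof. by move=> t0; rewrite lerDr ln_ge0// lerDl ltW. Qed.

Lemma expR_Mlog t : 0 < t -> expR (Mlog t) = expR 8 * (1 + t).
Proof. by move=> t0; rewrite expRD lnK ?posrE 1?mulrC// addr_gt0. Qed.

(** The bound of [condrisk_le] at [L = ln m], with [1/m] encoded as [exp(-L)]. *)
Definition rbound t L : R :=
  L ^+ 2 * (1 - expR (- (t * expR (- L)))) +
  expR (- (t * expR (- L))) * (ln (1 + t * expR (- L)) + 8) ^+ 2.

(** With [d = 1 - 1/a], the assumption gives [t <= exp(Mlog t) <= exp(L/a)], so the chance of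
    missing is at most [t exp(-L) <= exp(-dL)]. Thus the bias is bounded, while [L^p >= 1]. *)
Lemma bias_small_of_large p a : 0 < p < 2 -> 1 < a -> exists2 C, 0 <= C &
  forall t L, 0 < t -> a * Mlog t < L ->
    L ^+ 2 * (1 - expR (- (t * expR (- L)))) <= C * L `^ p.
Proof.
move=> /andP[p0 p2] a1; pose d := 1 - a^-1.
have a0 : 0 < a by exact: lt_trans a1.
have d0 : 0 < d by rewrite subr_gt0 invf_lt1.
exists (2 / d ^+ 2); first by rewrite divr_ge0// sqr_ge0.
move=> t L t0 aML; have M8 := Mlog_ge8 _ t0.
have L1 : 1 <= L by nra.
have L0 : 0 <= L by lra.
have tM : t <= expR (Mlog t).
  rewrite expR_Mlog//; have := @expR_ge1Dx R 8; nra.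
have h1 : 1 - expR (- (t * expR (- L))) <= expR (- (d * L)).
  have := expR_ge1Dx (- (t * expR (- L))).
  have : t * expR (- L) <= expR (- (d * L)).
    apply: (@le_trans _ _ (expR (Mlog t) * expR (- L))).
      by rewrite ler_wpM2r ?expR_ge0.
    rewrite -expRD ler_expR /d mulrBl mul1r opprB lerB//.
    by rewrite ler_pdivlMl// ltW.
  set w := t * expR _; set z := expR (- w); set y := expR _; lra.
have dL : 0 <= d * L by rewrite mulr_ge0// ltW.
have h2 : L ^+ 2 * expR (- (d * L)) <= 2 / d ^+ 2.
  have := expR_ge_pow _ 1 dL; rewrite expRN (_ : 2`!%:R = 2)// => h.
  rewrite ler_pdivrMr ?expR_gt0// mulrAC ler_pdivlMr ?exprn_gt0//.
  move: h; rewrite exprMn; set z := expR _; lra.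
have h3 := powR_ge1 p L (ltW p0) L1.
apply: (@le_trans _ _ (L ^+ 2 * expR (- (d * L)))).
  by rewrite ler_wpM2l ?sqr_ge0.
by rewrite (le_trans h2)// ler_peMr// divr_ge0// sqr_ge0.
Qed.

(** Below the cutoff [a * Mlog t], write [L^2 = L^p L^(2-p)] and bound the second factor. The weight
    [1 - c] is kept so that it can be combined with the weight [c] of [false_discovery_le]. *)
Lemma bias_le p a : 0 < p < 2 -> 1 < a -> exists2 C, 0 <= C &
  forall t L, 0 < t -> 0 <= L ->
    L ^+ 2 * (1 - expR (- (t * expR (- L)))) <=
    (1 - expR (- (t * expR (- L)))) * (a ^+ 2 * Mlog t `^ (2 - p) * L `^ p) + C * L `^ p.
Proof.
move=> pp a1; have /andP[p0 p2] := pp.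
have [C C0 hC] := bias_small_of_large _ _ pp a1; exists C => // t L t0 L0.
have M8 := Mlog_ge8 _ t0.
set s := expR (- _); have s1 : 0 <= 1 - s.
  by rewrite subr_ge0 expR_le1 oppr_le0 mulr_ge0 ?expR_ge0// ltW.
have [LM|/hC] := leP L (a * Mlog t); last first.
  move=> /(_ t0) h; rewrite (le_trans h)// lerDr mulr_ge0// mulr_ge0 ?powR_ge0//.
  by rewrite mulr_ge0 ?powR_ge0// sqr_ge0.
rewrite (@le_trans _ _ ((1 - s) * (a ^+ 2 * Mlog t `^ (2 - p) * L `^ p)))//; last first.
  by rewrite lerDl mulr_ge0 ?powR_ge0.
rewrite mulrC ler_wpM2l// (sqr_powR_split p)// mulrC ler_wpM2r ?powR_ge0//.
apply: powR_le_sqr_mul => //; lra.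
Qed.

(** Away from the null, [1 / L^p] grows at most polynomially in [t], which exponential decay will
    beat. *)
Lemma powR_le_of_mul_ge p k t L : 0 < p < 2 -> 0 < k -> 0 < t -> 0 <= L -> k <= t * L ->
  k `^ p <= (1 + t) ^+ 2 * L `^ p.
Proof.
move=> /andP[p0 p2] k0 t0 L0 ktL.
apply: powR_le_sqr_mul => //; rewrite ?(ltW p0) ?(ltW p2)//; nra.
Qed.

(** Since [t exp(-L) >= t - tL > t - ln a], such a mean reports at most [a] times as often as the
    null. *)
Lemma variance_le_near a t L : 1 < a -> 0 < t -> 0 <= L -> t * L < ln a ->
  expR (- (t * expR (- L))) <= a * expR (- t) /\
  expR (- (t * expR (- L))) * (ln (1 + t * expR (- L)) + 8) ^+ 2 <=
    a * expR (- t) * Mlog t ^+ 2.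
Proof.
move=> a1 t0 L0 tL; have a0 : 0 < a by exact: lt_trans a1.
set u := t * expR (- L).
have u0 : 0 < u by rewrite mulr_gt0 ?expR_gt0.
have ut : u <= t by rewrite ler_piMr// ?(ltW t0)// expR_le1 oppr_le0.
have h : expR (- u) <= a * expR (- t).
  rewrite -[a in a * _]lnK ?posrE// -expRD ler_expR.
  have := expR_ge1Dx (- L); rewrite /u; set e := expR (- L) => he; nra.
split=> //; apply: ler_pM => //; rewrite ?expR_ge0 ?sqr_ge0//.
have l0 : 0 <= ln (1 + u) by rewrite ln_ge0// lerDl ltW.
rewrite ler_sqr ?nnegrE; [|lra|by have := Mlog_ge8 _ t0; lra].
by rewrite lerD2r ler_ln ?posrE ?lerD2l// addr_gt0.
Qed.

Lemma expR_le_half1 : expR (- 1) <= 2^-1 :> R.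
Proof.
rewrite expRN lef_pV2 ?posrE ?expR_gt0//.
by have := @expR_ge1Dx R 1; lra.
Qed.

Lemma expR_ge_quarter1 : 4^-1 <= expR (- 1) :> R.
Proof.
have : 1 + - 1 / 2 <= expR (- 1 / 2 : R) by exact: expR_ge1Dx.
have : expR (- 1 / 2) * expR (- 1 / 2) = expR (-1) :> R.
  by rewrite -expRD; congr expR; lra.
nra.
Qed.

(** With [u = t exp(-L)], the left side is at most [64 exp(-u/2)]. For [L >= 1] this is bounded and
    [L^p >= 1]; for [L < 1], [u >= t/4] and [exp(-t/8)] absorbs the factor [(1 + t)^2] of
    [powR_le_of_mul_ge]. *)
Lemma variance_le_far p k : 0 < p < 2 -> 0 < k -> exists2 C, 0 <= C &
  forall t L, 0 < t -> 0 <= L -> k <= t * L ->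
    expR (- (t * expR (- L))) * (ln (1 + t * expR (- L)) + 8) ^+ 2 <= C * L `^ p.
Proof.
move=> pp k0; have /andP[p0 p2] := pp.
have kp0 : 0 < k `^ p by rewrite powR_gt0.
exists (64 + 64 * (16 ^+ 2 / k `^ p)).
  by rewrite addr_ge0// mulr_ge0// divr_ge0 ?sqr_ge0// ltW.
move=> t L t0 L0 ktL.
set u := t * expR (- L).
have u0 : 0 < u by rewrite mulr_gt0 ?expR_gt0.
have Lp0 : 0 <= L `^ p by rewrite powR_ge0.
have h1 : expR (- u) * (ln (1 + u) + 8) ^+ 2 <= 64 * expR (- (u / 2)).
  have l0 : 0 <= ln (1 + u) by rewrite ln_ge0// lerDl ltW.
  have l1 : ln (1 + u) <= u by apply: le_ln1Dx; lra.
  have e1 := expR_ge1Dx (u / 4).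
  have -> : expR (- u) = expR (- (u / 2)) * (expR (- (u / 4)) * expR (- (u / 4))).
    by rewrite -!expRD; congr expR; lra.
  rewrite -mulrA [leRHS]mulrC ler_wpM2l ?expR_ge0//.
  have e2 : expR (u / 4) * expR (- (u / 4)) = 1 by rewrite expRxMexpNx_1.
  have e3 : 0 < expR (- (u / 4)) by rewrite expR_gt0.
  move: e1 e2 e3; set x := expR (u / 4); set y := expR _ => e1 e2 e3.
  have : (ln (1 + u) + 8) * y <= 8 by nra.
  have : 0 <= (ln (1 + u) + 8) * y by nra.
  set z := _ * y => z0 z8.
  rewrite [leLHS](_ : _ = z * z); last by rewrite /z; ring.
  nra.
apply: (le_trans h1).
have [L1|L1] := leP 1 L.
  have := powR_ge1 p L (ltW p0) L1.
  have : expR (- (u / 2)) <= 1 by rewrite expR_le1 oppr_le0; lra.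
  have : 0 <= 16 ^+ 2 / k `^ p by rewrite divr_ge0 ?sqr_ge0// ltW.
  set z := 16 ^+ 2 / _; set e := expR _ => z0 e1 lp; nra.
have u4 : t / 4 <= u.
  rewrite /u ler_wpM2l ?(ltW t0)// (le_trans expR_ge_quarter1)// ler_expR; lra.
have e1 : expR (- (u / 2)) <= expR (- (t / 8)) by rewrite ler_expR; lra.
have kp := powR_le_of_mul_ge _ _ _ _ pp k0 t0 L0 ktL.
have e2 : (1 + t) ^+ 2 * expR (- (t / 8)) <= 16 ^+ 2.
  have e3 := expR_ge1Dx (t / 16).
  have -> : expR (- (t / 8)) = expR (- (t / 16)) * expR (- (t / 16)).
    by rewrite -!expRD; congr expR; lra.
  have : expR (t / 16) * expR (- (t / 16)) = 1 by rewrite expRxMexpNx_1.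
  have : 0 < expR (- (t / 16)) by rewrite expR_gt0.
  move: e3; set x := expR (t / 16); set y := expR _ => e1' e2' e3'.
  have : (1 + t) * y <= 16 by nra.
  have : 0 <= (1 + t) * y by nra.
  set z := _ * y => z0 z8.
  rewrite [leLHS](_ : _ = z * z); last by rewrite /z; ring.
  nra.
have e4 : k `^ p * expR (- (t / 8)) <= 16 ^+ 2 * L `^ p.
  apply: (@le_trans _ _ ((1 + t) ^+ 2 * L `^ p * expR (- (t / 8)))).
    by rewrite ler_wpM2r ?expR_ge0.
  by rewrite mulrAC ler_wpM2r.
have e5 : expR (- (t / 8)) <= 16 ^+ 2 / k `^ p * L `^ p.
  by rewrite mulrAC ler_pdivlMr// mulrC.
rewrite [leRHS](_ : _ = 64 * L `^ p + 64 * (16 ^+ 2 / k `^ p * L `^ p)); last by ring.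
have : 0 <= 64 * L `^ p by rewrite mulr_ge0.
move: e5 e1; set x := 16 ^+ 2 / _ * _; set y := expR _; set w := expR _; lra.
Qed.

(** If [Mlog t <= a L], part of [Mlog t ^+ 2] is traded for [L^p]. Otherwise [t exp(-L)] is at least
    a constant times a positive power of [exp(Mlog t)], except for small [t], and its exponential
    beats every power of [t]. *)
Lemma false_discovery_le p a k : 0 < p < 2 -> 1 < a -> 0 < k -> exists2 C, 0 <= C &
  forall t L, 0 < t -> 0 <= L -> k <= t * L ->
    Mlog t ^+ 2 * expR (- (t * expR (- L))) <=
    expR (- (t * expR (- L))) * (a ^+ 2 * Mlog t `^ (2 - p) * L `^ p) + C * L `^ p.
Proof.
move=> pp a1 k0; have /andP[p0 p2] := pp.
have a0 : 0 < a by exact: lt_trans a1.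
have kp0 : 0 < k `^ p by rewrite powR_gt0.
pose d := 1 - a^-1.
have d0 : 0 < d by rewrite subr_gt0 invf_lt1.
(* The exponent 3 pays one factor [exp(Mlog t)] for [Mlog t ^+ 2] and two for [(1 + t)^2]. *)
have [n hn] : exists n : nat, 3 <= n.+1%:R * d.
  exists (Num.truncn (3 / d)).
  by rewrite -ler_pdivrMr// ltW// truncnS_gt.
(* The first summand serves [t >= 1]; [18^2 = 81 * 4] serves [t < 1]. *)
pose C := 2 * n.+1`!%:R * expR (9 * n.+1%:R) + 18 ^+ 2 : R.
have C0 : 0 <= C by rewrite addr_ge0// mulr_ge0 ?expR_ge0.
exists (C / k `^ p); first by rewrite divr_ge0// ltW.
move=> t L t0 L0 ktL.
have M8 := Mlog_ge8 _ t0.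
have Lp0 : 0 <= L `^ p by rewrite powR_ge0.
set u := t * expR (- L); have u0 : 0 < u by rewrite mulr_gt0 ?expR_gt0.
have [ML|LM] := leP (Mlog t) (a * L).
  rewrite (@le_trans _ _ (expR (- u) * (a ^+ 2 * Mlog t `^ (2 - p) * L `^ p)))//; last first.
    by rewrite lerDl mulr_ge0// divr_ge0// ltW.
  rewrite mulrC ler_wpM2l ?expR_ge0// (sqr_powR_split p); last lra.
  rewrite mulrC [a ^+ 2 * _]mulrC -mulrA ler_wpM2l ?powR_ge0//.
  by apply: powR_le_sqr_mul => //; lra.
rewrite (@le_trans _ _ (C / k `^ p * L `^ p))//; last first.
  by rewrite lerDr mulr_ge0 ?expR_ge0// mulr_ge0// mulr_ge0 ?powR_ge0 ?sqr_ge0.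
have kp := powR_le_of_mul_ge _ _ _ _ pp k0 t0 L0 ktL.
suff h : Mlog t ^+ 2 * expR (- u) * (1 + t) ^+ 2 <= C.
  rewrite [leRHS]mulrAC ler_pdivlMr//.
  apply: (@le_trans _ _ (Mlog t ^+ 2 * expR (- u) * ((1 + t) ^+ 2 * L `^ p))).
    by rewrite ler_wpM2l// mulr_ge0 ?sqr_ge0 ?expR_ge0.
  by rewrite mulrA ler_wpM2r.
have M2 : Mlog t ^+ 2 <= 2 * expR (Mlog t).
  have := expR_ge_pow (Mlog t) 1; rewrite (_ : 2`!%:R = 2)// => h.
  have := h _; lra.
have eM : 1 + t <= expR (Mlog t).
  by rewrite expR_Mlog//; have := @expR_ge1Dx R 8; nra.
have [t1|t1] := ltP t 1.
  have l1 : ln (1 + t) <= t by apply: le_ln1Dx; lra.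
  have : Mlog t ^+ 2 <= 81 by move: M8; rewrite /Mlog; nra.
  have : expR (- u) <= 1 by rewrite expR_le1 oppr_le0 ltW.
  have : 0 <= Mlog t ^+ 2 by rewrite sqr_ge0.
  have : 0 < expR (- u) by rewrite expR_gt0.
  have : (1 + t) ^+ 2 <= 4 by nra.
  have : 0 <= (1 + t) ^+ 2 by rewrite sqr_ge0.
  set x := (1 + t) ^+ 2; set y := Mlog t ^+ 2; set z := expR _ => x0 x4 z0 y0 z1 y81.
  have : y * z <= 81 by nra.
  have : 0 <= y * z by nra.
  have : 0 <= 2 * n.+1`!%:R * expR (9 * n.+1%:R) :> R by rewrite mulr_ge0 ?expR_ge0.
  rewrite /C; set w := _ * expR _; set v := y * z; nra.
have ut : expR (d * Mlog t - 9) <= u.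
  (* Here 9 is [8 + 1]: the left side is [(1 + t) / e <= (1 + t) / 2], at most [t] because
     [t >= 1]. *)
  have t2 : expR (Mlog t - 9) <= t.
    rewrite expRD expR_Mlog// mulrAC -expRD (_ : 8 - 9 = - 1); last by lra.
    have := expR_le_half1; set e := expR _; nra.
  apply: (@le_trans _ _ (expR (Mlog t - 9) * expR (- L))).
    rewrite -expRD ler_expR /d mulrBl mul1r.
    have : L <= a^-1 * Mlog t by rewrite ler_pdivlMl// ltW.
    set w := a^-1 * _; lra.
  by rewrite ler_wpM2r ?expR_ge0.
have hu : expR (3 * Mlog t) * expR (- u) <= n.+1`!%:R * expR (9 * n.+1%:R).
  have fn0 : 0 < n.+1`!%:R :> R by rewrite ltr0n fact_gt0.
  have := expR_ge_pow _ n (ltW u0); rewrite ler_pdivrMr// => h.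
  rewrite expRN ler_pdivrMr ?expR_gt0//.
  rewrite mulrAC [n.+1`!%:R * _]mulrC.
  apply: (@le_trans _ _ (u ^+ n.+1 * expR (9 * n.+1%:R))); last first.
    by rewrite ler_wpM2r ?expR_ge0.
  apply: (@le_trans _ _ (expR (d * Mlog t - 9) ^+ n.+1 * expR (9 * n.+1%:R))).
    rewrite -expRM_natl -expRD ler_expR; nra.
  rewrite ler_wpM2r ?expR_ge0//; apply: lerXn2r => //; rewrite nnegrE ?expR_ge0//.
  exact: ltW.
apply: (@le_trans _ _ (2 * (expR (3 * Mlog t) * expR (- u)))).
  rewrite (_ : expR (3 * Mlog t) = expR (Mlog t) * expR (Mlog t) ^+ 2); last first.
    by rewrite -expRM_natl -expRD; congr expR; ring.
  rewrite [leLHS](_ : _ = Mlog t ^+ 2 * (1 + t) ^+ 2 * expR (- u)); last by ring.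
  rewrite [2 * (_ * expR (- u))]mulrA ler_wpM2r ?expR_ge0// [2 * _]mulrA.
  apply: ler_pM => //; rewrite ?sqr_ge0//; apply: lerXn2r => //.
    by rewrite nnegrE; lra.
  by rewrite nnegrE expR_ge0.
rewrite /C -mulrA; lra.
Qed.

(* The multiplier [Q * Mlog t ^+ 2] prices the FDR constraint [e^{-t}/q <= Gbar t]: integrating
   the inequality below against the prior, the two terms it carries cancel. *)
Lemma rbound_le_lagrange p q a : 0 < p < 2 -> 0 < q -> 1 < a -> a * q < 1 ->
  exists2 C, 0 <= C & forall t L, 0 < t -> 0 <= L ->
    rbound t L + a * q / (1 - a * q) * Mlog t ^+ 2 * expR (- (t * expR (- L))) <=
    (a ^+ 2 * Num.max 1 (a * q / (1 - a * q)) * Mlog t `^ (2 - p) + C) * L `^ p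
      + a * q / (1 - a * q) * Mlog t ^+ 2 * (q^-1 * expR (- t)).
Proof.
move=> pp q0 a1 aq1; set Q := a * q / (1 - a * q).
have a0 : 0 < a by exact: lt_trans a1.
have Q0 : 0 <= Q by rewrite divr_ge0 ?mulr_ge0 ?subr_ge0// ltW.
have QE : Q / q = a + Q * a.
  by rewrite /Q; field; rewrite !gt_eqF ?subr_gt0.
clearbody Q.
have la0 : 0 < ln a by rewrite ln_gt0.
have [C1 C10 hC1] := bias_le _ _ pp a1.
have [C2 C20 hC2] := variance_le_far _ _ pp la0.
have [C3 C30 hC3] := false_discovery_le _ _ _ pp a1 la0.
exists (C1 + C2 + Q * C3); first by rewrite !addr_ge0// mulr_ge0.
move=> t L t0 L0.
have := hC1 _ _ t0 L0; have := hC2 _ _ t0 L0; have := hC3 _ _ t0 L0.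
have := variance_le_near _ _ _ a1 t0 L0.
have Lp0 : 0 <= L `^ p by rewrite powR_ge0.
have s1 : expR (- (t * expR (- L))) <= 1.
  by rewrite expR_le1 oppr_le0 mulr_ge0 ?expR_ge0// ltW.
have s0 : 0 <= expR (- (t * expR (- L))) by rewrite expR_ge0.
rewrite /rbound.
move: s0 s1; set s := expR (- (t * _)); set v := _ + 8; set P := L `^ p in Lp0 *.
move=> s0 s1 hn hf hv hb.
set m := Num.max 1 Q.
have m1 : 1 <= m by rewrite le_max lexx.
have mQ : Q <= m by rewrite le_max lexx orbT.
rewrite [leRHS](_ : _ = m * (a ^+ 2 * Mlog t `^ (2 - p) * P) + (C1 + C2 + Q * C3) * P
   + Q / q * (expR (- t) * Mlog t ^+ 2)); last by ring.
have X0 : 0 <= a ^+ 2 * Mlog t `^ (2 - p) * P.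
  by rewrite mulr_ge0// mulr_ge0 ?sqr_ge0 ?powR_ge0.
move: hb hf X0; set X := _ * P => hb hf X0.
have CP1 : 0 <= C1 * P by rewrite mulr_ge0.
have CP2 : 0 <= C2 * P by rewrite mulr_ge0.
have CP3 : 0 <= Q * (C3 * P) by rewrite mulr_ge0// mulr_ge0.
(* The weights [1 - s] and [Q s] sum to at most [max 1 Q], whence the constant of the limit. *)
have hX : (1 - s) * X + Q * (s * X) <= m * X.
  have -> : (1 - s) * X + Q * (s * X) = ((1 - s) + Q * s) * X by ring.
  rewrite ler_wpM2r//; nra.
have hX1 : (1 - s) * X <= m * X by rewrite ler_wpM2r//; lra.
rewrite !mulrDl.
have [tL|tL] := ltP (t * L) (ln a); last first.
  have hf' : Q * (Mlog t ^+ 2 * s) <= Q * (s * X + C3 * P) by rewrite ler_wpM2l// hf.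
  have hv' := hv tL.
  have : 0 <= Q / q * (expR (- t) * Mlog t ^+ 2).
    by apply: mulr_ge0; [rewrite divr_ge0// ltW|rewrite mulr_ge0 ?expR_ge0 ?sqr_ge0].
  lra.
have [h1 h2] := hn tL.
rewrite QE.
have h3 : Q * Mlog t ^+ 2 * s <= Q * Mlog t ^+ 2 * (a * expR (- t)).
  by rewrite ler_wpM2l// mulr_ge0 ?sqr_ge0.
lra.
Qed.

(** For [1 < L <= 2 Mlog t], the bias [4 Mlog^2] is multiplied by [exp(t/4 - (t/2) exp(-L)) >= 1],
    using [exp(-1) <= 1/2]. Integrated, this factor becomes [Gbar] at [t/2], a point below the
    threshold where [Gbar] is under control. *)
Lemma rbound_le_crude p : 0 < p < 2 -> exists2 C, 0 <= C & forall t L, 0 < t -> 0 <= L ->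
  rbound t L <= C * L `^ p
    + Mlog t ^+ 2 * (4 * expR (t / 4) * expR (- (t / 2 * expR (- L))) + 3 * expR (- t)).
Proof.
move=> pp; have /andP[p0 p2] := pp.
have a1 : 1 < 2 :> R by lra.
have a3 : 1 < 3 :> R by lra.
have la0 : 0 < ln 3 :> R by rewrite ln_gt0.
have [C1 C10 hC1] := bias_small_of_large _ _ pp a1.
have [C2 C20 hC2] := variance_le_far _ _ pp la0.
exists (1 + C1 + C2); first by rewrite !addr_ge0.
move=> t L t0 L0.
have := hC1 _ L t0; have := hC2 _ _ t0 L0.
have := variance_le_near _ _ _ a3 t0 L0.
have Lp0 : 0 <= L `^ p by rewrite powR_ge0.
have s1 : expR (- (t * expR (- L))) <= 1.
  by rewrite expR_le1 oppr_le0 mulr_ge0 ?expR_ge0// ltW.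
have s0 : 0 <= expR (- (t * expR (- L))) by rewrite expR_ge0.
have L2s : L ^+ 2 * (1 - expR (- (t * expR (- L)))) <= L ^+ 2.
  by rewrite ler_piMr ?sqr_ge0// lerBlDr lerDl.
rewrite /rbound.
move: s0 s1 L2s; set s := expR (- (t * _)); set v := _ + 8.
move=> s0 s1 L2s hn hv hb.
have M8 := Mlog_ge8 _ t0.
have M0 : 0 <= Mlog t ^+ 2 by rewrite sqr_ge0.
pose W := 4 * expR (t / 4) * expR (- (t / 2 * expR (- L))).
have W0 : 0 <= W by rewrite !mulr_ge0 ?expR_ge0.
have bias : L ^+ 2 * (1 - s) <= (1 + C1) * L `^ p + Mlog t ^+ 2 * W.
  have MW0 : 0 <= Mlog t ^+ 2 * W by rewrite mulr_ge0.
  have CL0 : 0 <= C1 * L `^ p by rewrite mulr_ge0.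
  rewrite mulrDl mul1r.
  have [L1|L1] := leP L 1.
    have : L ^+ 2 <= L `^ p.
      have [->|Ln0] := eqVneq L 0; first by rewrite expr0n powR_ge0.
      have Lgt0 : 0 < L by rewrite lt0r Ln0.
      by rewrite -powR_mulrn// ger_powR ?Lgt0 ?L1 ?(ltW p2).
    lra.
  have [L2M|/hb] := leP L (2 * Mlog t); last by lra.
  have LM2 : L ^+ 2 <= Mlog t ^+ 2 * 4 by nra.
  have : Mlog t ^+ 2 * 4 <= Mlog t ^+ 2 * W.
    rewrite ler_wpM2l// /W -mulrA ler_peMr// -expRD -[leLHS](@expR0 R) ler_expR.
    have : expR (- L) <= 2^-1 by rewrite (le_trans _ expR_le_half1)// ler_expR lerN2 ltW.
    by set e := expR _; nra.
  lra.
have var : s * v ^+ 2 <= C2 * L `^ p + Mlog t ^+ 2 * (3 * expR (- t)).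
  have [tL|tL] := ltP (t * L) (ln 3); last first.
    by rewrite (le_trans (hv tL))// lerDl mulr_ge0// mulr_ge0 ?expR_ge0.
  have [_ h] := hn tL.
  by rewrite (le_trans h)// mulrC lerDr mulr_ge0.
rewrite -/W mulrDr mulrDl; lra.
Qed.

End pointwise_bounds.

Arguments Mlog {R} t.
Arguments rbound {R} t L.

(** * The FDR threshold *)

Section fdr_functional.
Variables (R : realType) (F : probability R R).
Hypothesis F_ge1 : F [set x : R | x < 1] = 0%E.
Implicit Types (q t : R) (f : R -> R) (g : R -> \bar R).

Lemma measurable_lt1 : measurable [set x : R | x < 1].
Proof.
rewrite (_ : [set x : R | x < 1] = `]-oo, 1[%classic).
  exact: measurable_itv.
by apply/seteqP; split => x /=; rewrite in_itv.
Qed.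

Let off_null x : ~ [set x : R | x < 1] x -> 1 <= x.
Proof. by move=> /negP; rewrite -leNgt. Qed.

Lemma measurable_survival t :
  measurable_fun [set: R] (fun m => (expR (- (t * expR (- ln m))))%:E).
Proof.
apply/measurable_EFinP; apply: (measurableT_comp (@measurable_expR R)).
apply: measurable_funN; apply: measurable_funM => //.
apply: (measurableT_comp (@measurable_expR R)).
by apply: measurable_funN; exact: measurable_ln.
Qed.

Lemma expRN_ln m : 1 <= m -> expR (- ln m) = m^-1 :> R.
Proof. by move=> m1; rewrite expRN lnK// posrE (lt_le_trans ltr01). Qed.

(** The integrands agree on [[1, +oo[], which carries [F]; the new one is measurable by
    composition. *)
Lemma GbarE t : Gbar F t = (\int[F]_m (expR (- (t * expR (- ln m))))%:E)%E.
Proof.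
apply/eqP; rewrite eq_le; apply/andP; split.
- apply: (le_integral_off_null _ _ _ F _ _ _ measurable_lt1 F_ge1 (measurable_survival t)) => x.
    by rewrite lee_fin expR_ge0.
  by move=> /off_null x1; rewrite expRN_ln.
- apply: (ge_integral_off_null _ _ _ F _ _ _ measurable_lt1 F_ge1 (measurable_survival t)) => x.
    by rewrite lee_fin expR_ge0.
  by move=> /off_null x1; rewrite expRN_ln.
Qed.

Lemma Gbar_ge0 t : (0 <= Gbar F t)%E.
Proof. by apply: integral_ge0 => x _; rewrite lee_fin expR_ge0. Qed.

Lemma Gbar_le s t : s <= t -> (Gbar F t <= Gbar F s)%E.
Proof.
move=> st; rewrite !GbarE; apply: le_ge0_integral => x _; rewrite lee_fin ?expR_ge0//.
by rewrite ler_expR lerN2 ler_wpM2r ?expR_ge0.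
Qed.

Lemma Gbar_le1 t : 0 <= t -> (Gbar F t <= 1)%E.
Proof.
move=> t0; rewrite GbarE.
apply: (@le_trans _ _ (\int[F]_m (cst 1%E : R -> \bar R) m)%E).
  apply: le_ge0_integral => x _; rewrite lee_fin ?expR_ge0//.
  by rewrite expR_le1 oppr_le0 mulr_ge0 ?expR_ge0.
by rewrite integral_cst// mul1e; exact: probability_le1.
Qed.

Lemma Gbar_fin t : 0 <= t -> Gbar F t \is a fin_num.
Proof.
by move=> /Gbar_le1 h; rewrite ge0_fin_numE ?Gbar_ge0// (le_lt_trans h)// ltry.
Qed.

Lemma Tq_ge0 q : (0 <= Tq q F)%E.
Proof. by apply: le_ereal_inf_tmp => _ [t [t0 _] <-]; rewrite lee_fin. Qed.

Lemma Gbar_lt_of_lt_Tq q t : 0 <= t -> (t%:E < Tq q F)%E -> (Gbar F t < (q^-1 * Ebar t)%:E)%E.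
Proof.
move=> t0; rewrite !ltNge; apply: contra => h.
by apply: ereal_inf_lbound; exists t.
Qed.

(* Only monotonicity of [Gbar] is used, so the infimum is attained without continuity of [Gbar]. *)
Lemma Gbar_ge_at_Tq q t : 0 < q -> Tq q F = t%:E -> ((q^-1 * Ebar t)%:E <= Gbar F t)%E.
Proof.
move=> q0 Tt; have t0 : 0 <= t by rewrite -lee_fin -Tt Tq_ge0.
rewrite -(fineK (Gbar_fin _ t0)) lee_fin leNgt; apply/negP => lt.
set g := fine _ in lt; set y := q^-1 * Ebar t in lt.
have y0 : 0 < y by rewrite mulr_gt0 ?invr_gt0 ?expR_gt0.
pose e := (y - g) / (2 * y).
have e0 : 0 < e by rewrite divr_gt0 ?subr_gt0// mulr_gt0.
have /ereal_inf_lt : (Tq q F < (t + e)%:E)%E by rewrite Tt lte_fin ltrDl.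
move=> [_ [s [s0 hs] <-]]; rewrite lte_fin => ste.
have ts : t <= s by rewrite -lee_fin -Tt; apply: ereal_inf_lbound; exists s.
have : ((q^-1 * Ebar (t + e))%:E <= Gbar F t)%E.
  rewrite (le_trans _ (Gbar_le _ _ ts))// (le_trans _ hs)// lee_fin.
  by rewrite ler_wpM2l ?invr_ge0 ?(ltW q0)// ler_expR lerN2 ltW.
rewrite -(fineK (Gbar_fin _ t0)) lee_fin -/g /Ebar opprD expRD mulrA -/(Ebar t) -/y.
have : y * (1 - e) <= y * expR (- e) by rewrite ler_wpM2l ?(ltW y0)// expR_ge1Dx.
have : y * e = (y - g) / 2 by rewrite /e; field; rewrite gt_eqF.
lra.
Qed.

(** A zero threshold would give [1/q <= Gbar F 0 <= 1]. *)
Lemma Tq_gt0 q t : 0 < q < 1 -> Tq q F = t%:E -> 0 < t.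
Proof.
move=> /andP[q0 q1] Tt; have t0 : 0 <= t by rewrite -lee_fin -Tt Tq_ge0.
rewrite lt0r t0 andbT; apply/eqP => tE.
have := le_trans (Gbar_ge_at_Tq _ _ q0 Tt) (Gbar_le1 _ t0).
by rewrite tE lee_fin /Ebar oppr0 expR0 mulr1 leNgt invf_gt1// q1.
Qed.

(** Now [Gbar t < exp(-t)/q] for every [t >= 0]. Integrating [t (1 - 1/m) <= exp(t - t/m)] gives at
    most [1/q], so [1 - 1/m] has integral at most [1/(tq)], hence 0. The mean is then almost surely
    1, which is also the estimate. *)
Lemma risk_pinfty q : 0 < q -> Tq q F = +oo%E -> (risk q F <= 0)%E.
Proof.
move=> q0 Too.
pose g := fun m : R => ((1 - expR (- ln m))%:E).
have mg : measurable_fun [set: R] g.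
  apply/measurable_EFinP; apply: measurable_funB => //.
  apply: (measurableT_comp (@measurable_expR R)).
  by apply: measurable_funN; exact: measurable_ln.
have Jle e : 0 < e -> (\int[F]_m `|g m| <= e%:E)%E.
  move=> e0; pose t := (q * e)^-1; have t0 : 0 < t by rewrite invr_gt0 mulr_gt0.
  have c0 : 0 <= t^-1 * expR t by rewrite mulr_ge0 ?expR_ge0// invr_ge0 (ltW t0).
  have tlt : (t%:E < Tq q F)%E by rewrite Too ltry.
  have := Gbar_lt_of_lt_Tq q t (ltW t0) tlt; rewrite GbarE => /ltW h.
  apply: (@le_trans _ _ (\int[F]_m ((t^-1 * expR t)%:E * (expR (- (t * expR (- ln m))))%:E))%E).
    apply: (le_integral_off_null _ _ _ F _ _ _ measurable_lt1 F_ge1) => [|x|x /off_null x1].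
    - by apply: measurable_funeM; exact: measurable_survival.
    - by rewrite -EFinM lee_fin mulr_ge0 ?expR_ge0.
    - rewrite /g /= lee_fin ger0_norm; last first.
        by rewrite subr_ge0 expR_le1 oppr_le0 ln_ge0.
      rewrite -mulrA -expRD ler_pdivlMl//.
      have := expR_ge1Dx (t + - (t * expR (- ln x))); lra.
  rewrite ge0_integralZl//; last exact: measurable_survival.
  apply: (@le_trans _ _ ((t^-1 * expR t)%:E * (q^-1 * Ebar t)%:E)%E).
    by apply: lee_wpmul2l.
  rewrite -EFinM lee_fin /Ebar expRN /t invrK.
  by rewrite le_eqVlt; apply/orP; left; apply/eqP; field; rewrite !gt_eqF ?expR_gt0.
have J0 : (\int[F]_m `|g m| = 0)%E.
  apply/eqP; rewrite eq_le integral_ge0 ?andbT//.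
  by apply/lee_addgt0Pr => e e0; rewrite add0e Jle.
have [N [mN FN hN]] := (ae_eq_integral_abs F measurableT mg).1 J0.
have -> : 0%E = (\int[F]_m (cst 0%E : R -> \bar R) m)%E by rewrite integral_cst// mul0e.
apply: (le_integral_off_null _ _ _ F ([set x : R | x < 1] `|` N)) => //.
- by apply: measurableU => //; exact: measurable_lt1.
- by rewrite null_set_setU //; exact: measurable_lt1.
move=> x /not_orP[/off_null x1 xN].
have lx : ln x = 0.
  have h : g x = cst 0%E x by apply: contrapT => h; apply: xN; apply: hN => /= /(_ I).
  have /(congr1 (@ln R)) : expR (- ln x) = 1 by case: h => /subr0_eq.
  by rewrite expRK ln1 => /eqP; rewrite oppr_eq0 => /eqP.
rewrite Too /condrisk integral0_eq// => y _.
by rewrite /delta leye_eq/= ln1 lx subr0 expr0n/= mul0r.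
Qed.

Lemma rbound_ge0 t x : 0 <= t -> 0 <= rbound t x.
Proof.
move=> t0; rewrite addr_ge0//; last by rewrite mulr_ge0 ?sqr_ge0 ?expR_ge0.
by rewrite mulr_ge0 ?sqr_ge0// subr_ge0 expR_le1 oppr_le0 mulr_ge0 ?expR_ge0.
Qed.

Lemma measurable_rbound t : measurable_fun [set: R] (fun m => (rbound t (ln m))%:E).
Proof.
have ml := @measurable_ln R.
have ms := (measurable_EFinP _ _).1 (measurable_survival t).
have mw : measurable_fun [set: R] (fun m : R => t * expR (- ln m)).
  apply: measurable_funM => //; apply: (measurableT_comp (@measurable_expR R)).
  exact: measurable_funN.
apply/measurable_EFinP; apply: measurable_funD.
  apply: measurable_funM; first exact: measurable_funX.
  exact: measurable_funB.
apply: measurable_funM => //; apply: measurable_funX.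
apply: measurable_funD => //; apply: (measurableT_comp ml).
exact: measurable_funD.
Qed.

Lemma risk_le_integral_rbound q t : 0 < q < 1 -> Tq q F = t%:E ->
  (risk q F <= \int[F]_m (rbound t (ln m))%:E)%E.
Proof.
move=> q01 Tt; have t0 := Tq_gt0 _ _ q01 Tt.
apply: (le_integral_off_null _ _ _ F _ _ _ measurable_lt1 F_ge1 (measurable_rbound t)) => x.
  by rewrite lee_fin rbound_ge0// ltW.
move=> /off_null x1; have x0 : 0 < x by exact: lt_le_trans x1.
by rewrite Tt (le_trans (condrisk_le _ _ _ t0 x0))// /rbound expRN_ln.
Qed.

(** Shared by the two upper bounds: the Lagrangian one takes [A = 0], the crude one [lam = 0] and
    [s = t / 2]. *)
Lemma risk_le_of_pointwise q p t s (K lam A B : R) : 0 < q < 1 -> Tq q F = t%:E ->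
  0 <= K -> 0 <= lam -> 0 <= A -> 0 <= B ->
  (forall x, 0 <= x -> rbound t x + lam * expR (- (t * expR (- x))) <=
                  K * x `^ p + (A * expR (- (s * expR (- x))) + B)) ->
  (risk q F + lam%:E * Gbar F t <= K%:E * moment p F + (A%:E * Gbar F s + B%:E))%E.
Proof.
move=> q01 Tt K0 l0 A0 B0 h; have t0 := Tq_gt0 _ _ q01 Tt.
apply: (@le_trans _ _ (\int[F]_m (rbound t (ln m))%:E + lam%:E * Gbar F t)%E).
  by rewrite leeD2r// risk_le_integral_rbound.
have ms u := measurable_survival u.
have mp : measurable_fun [set: R] (fun m => (ln m `^ p)%:E).
  apply/measurable_EFinP; apply: (measurableT_comp (@measurable_powR R p)).
  exact: measurable_ln.
have s0 u (m : R) : (0 <= (expR (- (u * expR (- ln m))))%:E)%E by rewrite lee_fin expR_ge0.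
have ZE c u : 0 <= c -> (c%:E * Gbar F u =
    \int[F]_m (c%:E * (expR (- (u * expR (- ln m))))%:E))%E.
  by move=> c0; rewrite GbarE ge0_integralZl//; exact: ms.
have -> : (K%:E * moment p F = \int[F]_m (K%:E * (ln m `^ p)%:E))%E.
  by rewrite ge0_integralZl// => x _; rewrite lee_fin powR_ge0.
have -> : B%:E = (\int[F]_m (cst B%:E : R -> \bar R) m)%E.
  rewrite integral_cst// [X in (_ * X)%E](_ : _ = 1%E) ?mule1//; exact: probability_setT.
rewrite !ZE//.
have mZ c u : measurable_fun [set: R] (fun m => (c%:E * (expR (- (u * expR (- ln m))))%:E)%E).
  by apply: measurable_funeM; exact: ms.
have mKp : measurable_fun [set: R] (fun m => (K%:E * (ln m `^ p)%:E)%E).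
  exact: measurable_funeM.
have p0 x : (0 <= K%:E * (ln x `^ p)%:E)%E by rewrite mule_ge0 ?lee_fin ?powR_ge0.
have z0 c u (x : R) : 0 <= c -> (0 <= c%:E * (expR (- (u * expR (- ln x))))%:E)%E.
  by move=> c0; rewrite mule_ge0.
have mB : measurable_fun [set: R] (cst B%:E : R -> \bar R) by exact: measurable_cst.
have mAB : measurable_fun [set: R] (fun m =>
    (A%:E * (expR (- (s * expR (- ln m))))%:E + (cst B%:E : R -> \bar R) m)%E).
  exact: emeasurable_funD.
have AB0 (x : R) : (0 <= A%:E * (expR (- (s * expR (- ln x))))%:E + (cst B%:E : R -> \bar R) x)%E.
  by rewrite adde_ge0 ?z0 ?lee_fin.
rewrite -(ge0_integralD F measurableT (fun x _ => z0 A s x A0) (mZ A s) _ mB)//.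
rewrite -(ge0_integralD F measurableT (fun x _ => p0 x) mKp _ mAB)//.
rewrite -(ge0_integralD F measurableT _ (measurable_rbound t) (fun x _ => z0 lam t x l0) (mZ lam t))//; last first.
  by move=> x _; rewrite lee_fin rbound_ge0// ltW.
apply: (le_integral_off_null _ _ _ F _ _ _ measurable_lt1 F_ge1) => [|x|x /off_null x1].
- exact: emeasurable_funD.
- by rewrite adde_ge0.
- by rewrite /= -!EFinM -!EFinD lee_fin h// ln_ge0.
Qed.


End fdr_functional.

(** * Upper bound on the worst-case risk *)

Section worst_case_risk.
Variable R : realType.
Implicit Types (F : probability R R) (q p a n t e : R).

Lemma Mlog_le (s t : R) : 0 <= s -> s <= t -> Mlog s <= Mlog t.
Proof. by move=> s0 st; rewrite lerD2r ler_ln ?posrE ?lerD2l//; lra. Qed.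

Lemma risk_le_lagrange q p a : 0 < q < 1 -> 0 < p < 2 -> 1 < a -> a * q < 1 ->
  exists2 C, 0 <= C & forall F n t, F [set x : R | x < 1] = 0%E ->
    (moment p F <= n%:E)%E -> Tq q F = t%:E ->
    (risk q F <=
     ((a ^+ 2 * Num.max 1 (a * q / (1 - a * q)) * Mlog t `^ (2 - p) + C) * n)%:E)%E.
Proof.
move=> q01 pp a1 aq1; have /andP[q0 q1] := q01.
have [C C0 hC] := rbound_le_lagrange _ _ _ _ pp q0 a1 aq1; exists C => // F n t F1 Fn Tt.
have t0 := Tq_gt0 _ _ F1 _ _ q01 Tt.
have Q0 : 0 <= a * q / (1 - a * q).
  by rewrite divr_ge0 ?mulr_ge0 ?subr_ge0 ?ltW// (lt_trans ltr01).
move: Q0 hC; set Q := _ / _ => Q0 hC.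
set K := _ * Mlog t `^ _ + C.
have K0 : 0 <= K.
  have m0 : 0 <= Num.max 1 Q by rewrite le_max ler01.
  by rewrite addr_ge0// mulr_ge0 ?powR_ge0// mulr_ge0 ?sqr_ge0.
have lam0 : 0 <= Q * Mlog t ^+ 2 by rewrite mulr_ge0 ?sqr_ge0.
have B0 : 0 <= Q * Mlog t ^+ 2 * (q^-1 * expR (- t)).
  by rewrite mulr_ge0// mulr_ge0 ?expR_ge0// invr_ge0 ltW.
have := risk_le_of_pointwise _ _ F1 q p t 0 K _ 0 _ q01 Tt K0 lam0 (lexx _) B0.
have hp x : 0 <= x -> rbound t x + Q * Mlog t ^+ 2 * expR (- (t * expR (- x))) <=
    K * x `^ p + (0 * expR (- (0 * expR (- x))) + Q * Mlog t ^+ 2 * (q^-1 * expR (- t))).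
  by move=> x0; rewrite !mul0r add0r; exact: hC.
move=> /(_ hp); rewrite mul0e add0e => h.
have gf := Gbar_fin _ F F1 t (ltW t0).
have := Gbar_ge_at_Tq _ _ F1 _ _ q0 Tt.
move: h; rewrite -(fineK gf); set g := fine _ => h; rewrite lee_fin /Ebar => hg.
(* [Gbar] is finite, so the multiplier term may be added on both sides; the FDR constraint at [t]
   then cancels it. *)
rewrite -(@leeD2rE _ (Q * Mlog t ^+ 2 * g)%:E)//.
rewrite (le_trans h)//; apply: leeD; last by rewrite lee_fin ler_wpM2l.
by rewrite EFinM lee_wpmul2l.
Qed.

(** Since [t/2] lies below the threshold, [Gbar (t/2) < exp(-t/2)/q]. Against the factor [exp(t/4)]
    this leaves [exp(-t/4)], half of which absorbs [Mlog t ^+ 2]. *)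
Lemma risk_le_crude q p : 0 < q < 1 -> 0 < p < 2 ->
  exists2 C, 0 <= C & forall F n t, F [set x : R | x < 1] = 0%E ->
    (moment p F <= n%:E)%E -> Tq q F = t%:E ->
    (risk q F <= (C * (n + expR (- (t / 8))))%:E)%E.
Proof.
move=> q01 pp; have /andP[q0 q1] := q01.
have [C C0 hC] := rbound_le_crude _ _ pp.
pose C1 := 16 ^+ 2 * (4 / q + 3).
have q40 : 0 <= 4 / q by rewrite divr_ge0// ltW.
have C10 : 0 <= C1 by rewrite mulr_ge0 ?sqr_ge0// addr_ge0.
exists (C + C1); first by rewrite addr_ge0.
move=> F n t F1 Fn Tt.
have t0 := Tq_gt0 _ _ F1 _ _ q01 Tt.
have A0 : 0 <= Mlog t ^+ 2 * (4 * expR (t / 4)) by rewrite mulr_ge0 ?sqr_ge0// mulr_ge0 ?expR_ge0.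
have B0 : 0 <= Mlog t ^+ 2 * (3 * expR (- t)) by rewrite mulr_ge0 ?sqr_ge0// mulr_ge0 ?expR_ge0.
have := risk_le_of_pointwise _ _ F1 q p t (t / 2) C 0 _ _ q01 Tt C0 (lexx _) A0 B0.
have hp x : 0 <= x -> rbound t x + 0 * expR (- (t * expR (- x))) <=
    C * x `^ p + (Mlog t ^+ 2 * (4 * expR (t / 4)) * expR (- (t / 2 * expR (- x))) +
                  Mlog t ^+ 2 * (3 * expR (- t))).
  by move=> x0; rewrite mul0r addr0 -mulrA -mulrDr; exact: hC.
move=> /(_ hp); rewrite mul0e adde0 => /le_trans; apply.
have t20 : 0 <= t / 2 by lra.
have gf := Gbar_fin _ F F1 (t / 2) t20.
have := Gbar_lt_of_lt_Tq _ F q (t / 2) t20.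
rewrite Tt lte_fin => /(_ _)/ltW; rewrite -(fineK gf); set g := fine _; rewrite lee_fin => hg.
have {}hg : g <= q^-1 * expR (- (t / 2)) by apply: hg; lra.
have n0 : 0 <= n.
  rewrite -lee_fin; apply: le_trans Fn; apply: integral_ge0 => x _.
  by rewrite lee_fin powR_ge0.
apply: (@le_trans _ _ (C * n + (Mlog t ^+ 2 * (4 * expR (t / 4)) * g
    + Mlog t ^+ 2 * (3 * expR (- t))))%:E).
  rewrite [leRHS]EFinD; apply: leeD; first by rewrite EFinM lee_wpmul2l.
  by rewrite -EFinM -EFinD.
rewrite lee_fin.
have M8 := Mlog_ge8 _ _ t0.
have Mt : Mlog t ^+ 2 * expR (- (t / 8)) <= 16 ^+ 2.
  have l1 : ln (1 + t) <= t by apply: le_ln1Dx; lra.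
  have e3 := expR_ge1Dx (t / 16).
  have -> : expR (- (t / 8)) = expR (- (t / 16)) ^+ 2.
    by rewrite -expRM_natl; congr expR; lra.
  have : expR (t / 16) * expR (- (t / 16)) = 1 by rewrite expRxMexpNx_1.
  have : 0 < expR (- (t / 16)) by rewrite expR_gt0.
  move: e3; set x := expR (t / 16); set y := expR _ => e1' e2' e3'.
  rewrite -exprMn; apply: lerXn2r; rewrite ?nnegrE//; first by rewrite mulr_ge0; lra.
  have : Mlog t <= 16 * x by rewrite /Mlog; lra.
  nra.
have step : Mlog t ^+ 2 * (4 * expR (t / 4)) * g + Mlog t ^+ 2 * (3 * expR (- t)) <=
    C1 * expR (- (t / 8)).
  apply: (@le_trans _ _ (Mlog t ^+ 2 * expR (- (t / 8)) * ((4 / q + 3) * expR (- (t / 8))))).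
    have e1 : expR (t / 4) * g <= q^-1 * (expR (- (t / 8)) * expR (- (t / 8))).
      have -> : expR (- (t / 8)) * expR (- (t / 8)) = expR (t / 4) * expR (- (t / 2)).
        by rewrite -!expRD; congr expR; lra.
      by rewrite mulrCA ler_wpM2l ?expR_ge0.
    have e2 : expR (- t) <= expR (- (t / 8)) * expR (- (t / 8)).
      by rewrite -expRD ler_expR; lra.
    rewrite [leRHS](_ : _ = Mlog t ^+ 2 * (4 * (q^-1 * (expR (- (t / 8)) * expR (- (t / 8))))
       + 3 * (expR (- (t / 8)) * expR (- (t / 8))))); last by ring.
    rewrite [leLHS](_ : _ = Mlog t ^+ 2 * (4 * (expR (t / 4) * g) + 3 * expR (- t))); last by ring.
    rewrite ler_wpM2l ?sqr_ge0//; lra.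
  by rewrite /C1 -[leRHS]mulrA ler_wpM2r// mulr_ge0 ?expR_ge0// addr_ge0.
have : 0 <= C1 * n by rewrite mulr_ge0.
have : 0 <= C * expR (- (t / 8)) by rewrite mulr_ge0 ?expR_ge0.
have -> : (C + C1) * (n + expR (- (t / 8))) =
  C * n + C1 * n + C * expR (- (t / 8)) + C1 * expR (- (t / 8)) by ring.
lra.
Qed.

Lemma ln_powR_expR p (eta : R) : 0 < eta -> eta `^ p = expR (- (p * ln eta^-1)).
Proof. by move=> eta0; rewrite lnV ?posrE// mulrN opprK /powR gt_eqF. Qed.

(** The thresholds are split at [8 p ln(1/eta)]: up to it the Lagrangian bound applies, and beyond
    it [exp(-t/8) <= eta^p] makes the crude bound [O(eta^p)]. *)
Lemma worst_risk_le q p a : 0 < q < 1 -> 0 < p < 2 -> 1 < a -> a * q < 1 ->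
  exists2 C, 0 <= C & forall eta : R, 0 < eta -> 1 <= ln eta^-1 ->
    (worst_risk q p eta <=
     ((a ^+ 2 * Num.max 1 (a * q / (1 - a * q)) * Mlog (8 * p * ln eta^-1) `^ (2 - p) + C)
        * eta `^ p)%:E)%E.
Proof.
move=> q01 pp a1 aq1; have /andP[q0 q1] := q01; have /andP[p0 p2] := pp.
have [C1 C10 h1] := risk_le_lagrange _ _ _ q01 pp a1 aq1.
have [C2 C20 h2] := risk_le_crude _ _ q01 pp.
exists (C1 + 2 * C2); first by rewrite addr_ge0// mulr_ge0.
move=> eta eta0 x1; set x := ln eta^-1 in x1 *.
have n0 : 0 <= eta `^ p by rewrite powR_ge0.
move: h1; set m := Num.max 1 _ => h1; have m0 : 0 <= m by rewrite le_max ler01.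
have am0 : 0 <= a ^+ 2 * m by rewrite mulr_ge0 ?sqr_ge0.
set B := _ * Mlog _ `^ _; have B0 : 0 <= B by rewrite mulr_ge0 ?powR_ge0.
have x0 : 0 <= 8 * p * x by rewrite !mulr_ge0// ltW//; lra.
apply: ge_ereal_sup => _ [F [F1 Fm] <-].
case Tt : (Tq q F) => [t| |]; last 2 first.
- rewrite (le_trans (risk_pinfty _ _ F1 _ q0 Tt))// lee_fin mulr_ge0// !addr_ge0//.
  by rewrite mulr_ge0.
- by have := Tq_ge0 _ F q; rewrite Tt.
have t0 := Tq_gt0 _ _ F1 _ _ q01 Tt.
have [tx|xt] := leP t (8 * p * x).
  rewrite (le_trans (h1 _ _ _ F1 Fm Tt))// lee_fin ler_wpM2r//.
  rewrite lerD ?lerDl ?mulr_ge0// ler_wpM2l// ge0_ler_powR ?nnegrE//.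
  - by lra.
  - by have := Mlog_ge8 _ _ t0; lra.
  - by have := Mlog_le _ _ (ltW t0) tx; have := Mlog_ge8 _ _ t0; lra.
  - exact: Mlog_le (ltW t0) tx.
rewrite (le_trans (h2 _ _ _ F1 Fm Tt))// lee_fin.
apply: (@le_trans _ _ (2 * C2 * eta `^ p)).
  rewrite [leRHS](_ : _ = C2 * (eta `^ p + eta `^ p)); last by ring.
  rewrite ler_wpM2l// lerD2l ln_powR_expR// -/x ler_expR lerN2; lra.
by rewrite ler_wpM2r// addrA lerDr addr_ge0.
Qed.

Lemma Lconst_ge1 q : q < 1 -> 1 <= Lconst q.
Proof.
move=> q1; rewrite /Lconst; case: ifPn => //; rewrite -ltNge => q2.
by rewrite ler_pdivlMr ?subr_gt0//; lra.
Qed.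

Lemma Lconst_ge q : q < 1 -> q / (1 - q) <= Lconst q.
Proof.
move=> q1; rewrite /Lconst; case: ifPn => // q2.
by rewrite ler_pdivrMr ?subr_gt0//; lra.
Qed.

(** This choice of [a] factors [1 - aq] as [(1 - q)(1 - dq)], so the odds [aq / (1 - aq)] exceed
    [q / (1 - q)] by the factor [a / (1 - dq)] only. *)
Lemma fdr_factor_le q (d : R) : 0 < q < 1 -> 0 < d < 1 ->
  let a := 1 + d * (1 - q) in
  [/\ 1 < a, a * q < 1, a <= 1 + d &
      Num.max 1 (a * q / (1 - a * q)) <= (1 + d) / (1 - d) * Lconst q].
Proof.
move=> /andP[q0 q1] /andP[d0 d1] a.
have L1 := Lconst_ge1 _ q1; have Lr := Lconst_ge _ q1.
have a1 : 1 < a by rewrite ltrDl mulr_gt0// subr_gt0.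
have aE : 1 - a * q = (1 - q) * (1 - d * q) by rewrite /a; ring.
have dq : d * q <= d by rewrite ler_piMr// ltW.
have dq1 : 0 < 1 - d * q by lra.
have q10 : 0 < 1 - q by lra.
have aq1 : a * q < 1 by rewrite -subr_gt0 aE mulr_gt0.
have ad : a <= 1 + d by rewrite lerD2l ler_piMr//; lra.
have d10 : 0 < 1 - d by lra.
have d1d : 1 <= (1 + d) / (1 - d) by rewrite ler_pdivlMr; lra.
split=> //; rewrite ge_max; apply/andP; split; first by rewrite -[leLHS]mulr1 ler_pM.
apply: (@le_trans _ _ ((1 + d) / (1 - d) * (q / (1 - q)))); last first.
  by rewrite ler_wpM2l// (le_trans ler01).
rewrite aE mulf_div ler_pM//.
- by rewrite mulr_ge0// ltW// (lt_trans ltr01).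
- by rewrite invr_ge0 mulr_ge0// ltW.
- by rewrite ler_wpM2r// ltW.
- by rewrite lef_pV2 ?posrE ?mulr_gt0// [leLHS]mulrC ler_wpM2l ?(ltW q10)// lerD2l lerN2.
Qed.

Lemma pow5_div_le (d : R) : 0 < d -> d <= 10^-1 -> (1 + d) ^+ 5 / (1 - d) <= 1 + 11 * d.
Proof.
move=> d0 d1; rewrite ler_pdivrMr; last lra.
have -> : (1 + d) ^+ 5 = 1 + d * (5 + 10 * d + 10 * d ^+ 2 + 5 * d ^+ 3 + d ^+ 4) by ring.
have d2 : d ^+ 2 <= 10^-1 * d by rewrite expr2 ler_wpM2r// ltW.
have d20 : 0 <= d ^+ 2 by rewrite sqr_ge0.
have d1' : d <= 1 by lra.
have d3 : d ^+ 3 <= d ^+ 2 by rewrite exprS ler_piMl.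
have d4 : d ^+ 4 <= d ^+ 2 by rewrite (_ : 4%N = (2 + 2)%N)// exprD ler_piMl// exprn_ile1// ltW.
have : 5 + 10 * d + 10 * d ^+ 2 + 5 * d ^+ 3 + d ^+ 4 <= 8 by lra.
set w := _ + d ^+ 4 => hw.
have : d * w <= d * 8 by rewrite ler_wpM2l// ltW.
lra.
Qed.

Lemma Mlog_scale_le p (d x : R) : 0 < p -> 0 < d -> 1 <= x ->
  (ln (1 + 8 * p) + 8) / d <= ln x -> Mlog (8 * p * x) <= (1 + d) * ln x.
Proof.
move=> p0 d0 x1; rewrite ler_pdivrMr// => h.
have px : 0 < 8 * p by rewrite mulr_gt0.
have x0 : 0 < x by exact: lt_le_trans x1.
have : ln (1 + 8 * p * x) <= ln (1 + 8 * p) + ln x.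
  rewrite -lnM ?posrE ?addr_gt0// ler_ln ?posrE ?addr_gt0 ?mulr_gt0 ?addr_gt0//.
  by rewrite [leRHS]mulrDl mul1r lerD2r.
rewrite /Mlog; lra.
Qed.

Lemma worst_risk_asymptotic_le q p e : 0 < q < 1 -> 0 < p < 2 -> 0 < e ->
  exists2 l0 : R, 0 < l0 & forall eta : R, 0 < eta -> l0 <= ln (ln eta^-1) ->
    (worst_risk q p eta <= ((1 + e) * Lconst q * rate p eta)%:E)%E.
Proof.
move=> q01 pp e0; have /andP[q0 q1] := q01; have /andP[p0 p2] := pp.
have L1 := Lconst_ge1 _ q1.
(* Of the 12 parts, 11 come from [pow5_div_le] and one absorbs the additive constant [C]. *)
pose d := Num.min 10^-1 (e / 12).
have d0 : 0 < d by rewrite lt_min invr_gt0 divr_gt0// ltr0n.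
have d1 : d <= 10^-1 by rewrite ge_min lexx.
have de : 12 * d <= e.
  have : d <= e / 12 by rewrite ge_min lexx orbT.
  lra.
clearbody d; have d11 : d < 1 by lra.
have d01 : 0 < d < 1 by rewrite d0.
have [] := fdr_factor_le _ _ q01 d01; set a := 1 + _ => a1 aq1 ad Q1.
have [C C0 hC] := worst_risk_le _ _ _ q01 pp a1 aq1.
move: Q1 hC; set m := Num.max 1 _ => Q1 hC.
have m0 : 0 <= m by rewrite le_max ler01.
pose C2 := ln (1 + 8 * p) + 8.
pose s := (2 - p)^-1.
have C20 : 0 <= C2 by rewrite addr_ge0// ln_ge0// lerDl mulr_ge0// ltW.
have Cd0 : 0 <= C2 / d by rewrite divr_ge0// ltW.
have Cs0 : 0 <= (C / d) `^ s by rewrite powR_ge0.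
(* The summands ensure, in order, [l >= 1], [Mlog (8 p x) <= (1 + d) l] and [C <= d l^(2-p)]. *)
exists (1 + C2 / d + (C / d) `^ s); first by rewrite ltr_wpDr// ltr_wpDr.
move=> eta eta0; set x := ln eta^-1; set l := ln x => hl.
have l1 : 1 <= l by rewrite (le_trans _ hl)// -addrA lerDl addr_ge0.
have lC2 : C2 / d <= l by rewrite (le_trans _ hl)// addrAC lerDr addr_ge0.
have lC : (C / d) `^ s <= l by rewrite (le_trans _ hl)// lerDr addr_ge0.
have l0 : 0 <= l by exact: le_trans l1.
(* [ln] is also nonpositive at nonpositive arguments, where it takes its default value 0, so
   [ln x >= 1] locates [x]. *)
have x1 : 1 <= x.
  rewrite leNgt; apply/negP => /ltW/ln_le0; rewrite -/l leNgt.
  by rewrite (lt_le_trans ltr01 l1).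
rewrite (le_trans (hC _ eta0 x1))// lee_fin -/x /rate -/x -/l.
rewrite [leRHS](_ : _ = (1 + e) * Lconst q * l `^ (2 - p) * eta `^ p); last by ring.
rewrite ler_wpM2r ?powR_ge0//.
have p20 : 0 < 2 - p by rewrite subr_gt0.
have ClM : C <= d * l `^ (2 - p).
  rewrite -ler_pdivrMl// mulrC.
  have -> : C / d = ((C / d) `^ s) `^ (2 - p).
    by rewrite -powRrM mulVf ?powRr1 ?divr_ge0 ?(ltW d0)// gt_eqF.
  by rewrite ge0_ler_powR ?nnegrE// ltW.
have Mx : Mlog (8 * p * x) <= (1 + d) * l by exact: Mlog_scale_le.
have Mx0 : 0 <= Mlog (8 * p * x).
  by rewrite (le_trans _ (Mlog_ge8 _ _ _))// !mulr_gt0// (lt_le_trans ltr01).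
have d1p : 1 <= 1 + d by rewrite lerDl ltW.
have MM : Mlog (8 * p * x) `^ (2 - p) <= (1 + d) ^+ 2 * l `^ (2 - p).
  by apply: powR_le_sqr_mul => //; rewrite (ltW p20) gerBl ltW.
have ap : a ^+ 2 * m <= (1 + d) ^+ 2 * ((1 + d) / (1 - d) * Lconst q).
  apply: ler_pM => //; first by rewrite sqr_ge0.
  by rewrite lerXn2r// nnegrE ?(le_trans _ (ltW a1))// (le_trans _ d1p).
apply: (@le_trans _ _ ((1 + d) ^+ 2 * ((1 + d) / (1 - d) * Lconst q) *
    ((1 + d) ^+ 2 * l `^ (2 - p)) + d * l `^ (2 - p))).
  rewrite lerD// ler_pM// ?powR_ge0//.
  by rewrite mulr_ge0// sqr_ge0.
rewrite [leLHS](_ : _ = ((1 + d) ^+ 5 / (1 - d) * Lconst q + d) * l `^ (2 - p)); last by ring.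
rewrite ler_wpM2r ?powR_ge0//.
have : (1 + d) ^+ 5 / (1 - d) * Lconst q <= (1 + 11 * d) * Lconst q.
  by rewrite ler_wpM2r ?pow5_div_le// (le_trans ler01).
have : 12 * d * Lconst q <= e * Lconst q by rewrite ler_wpM2r// (le_trans ler01).
have : d <= d * Lconst q by rewrite ler_peMr// ltW.
rewrite !mulrDl mul1r; set w := _ / _ * _; set z := d * _; set y := e * _ => h1 h2 h3.
apply: (le_trans (lerD h3 h1)).
apply: le_trans (lerD (lexx _) h2).
by move: h1 h2 h3; lra.
Qed.

End worst_case_risk.

(** * Two-point mixtures *)

Section two_point_mixture.
Variable R : realType.
Implicit Types (q p e mu t d c l : R).

Lemma mixture_probability e mu : 0 <= e <= 1 ->
  exists2 P : probability R R, (P : set R -> \bar R) = mixture e mu &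
    forall f : R -> \bar R, measurable_fun setT f -> (forall x, (0 <= f x)%E) ->
      (\int[P]_x f x = (1 - e)%:E * f 1%R + e%:E * f mu)%E.
Proof.
move=> /andP[e0 e1].
have e1' : 0 <= 1 - e by rewrite subr_ge0.
pose d1 : {measure set R -> \bar R} := @dirac _ R (1 : R) R.
pose d2 : {measure set R -> \bar R} := @dirac _ R mu R.
pose m1 : {measure set R -> \bar R} := mscale (NngNum e1') d1.
pose m2 : {measure set R -> \bar R} := mscale (NngNum e0) d2.
pose m : {measure set R -> \bar R} := measure_add m1 m2.
have mE A : m A = mixture e mu A by exact: measure_addE.
have mT : m setT = 1%E.
  by rewrite mE /mixture !diracT !mule1 -EFinD subrK.
(* Normalization supplies the probability structure; the total mass is already 1, so the measure is
   unchanged. *)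
pose P : probability R R := mnormalize m (@dirac _ R (1 : R) R).
have PE : (P : set R -> \bar R) = m.
  by apply/funext => A; rewrite /P /= /mnormalize mT/= onee_eq0/= invr1 mule1.
exists P; first by rewrite PE; apply/funext => A; exact: mE.
move=> f mf f0.
rewrite PE ge0_integral_measure_add//.
rewrite !ge0_integral_mscale// !integral_dirac//.
by rewrite !diracT !mul1e.
Qed.

Lemma mixture_lt1 e mu : 1 <= mu -> mixture e mu [set x : R | x < 1] = 0%E.
Proof.
move=> mu1; rewrite /mixture !diracE !memNset ?mule0 ?adde0//=; apply/negP.
  by rewrite -leNgt.
by rewrite ltxx.
Qed.

Lemma Gbar_mixture e mu t : 0 <= e <= 1 -> 1 <= mu ->
  Gbar (mixture e mu) t = ((1 - e) * expR (- t) + e * expR (- (t / mu)))%:E.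
Proof.
move=> e01 mu1; have [P PE intP] := mixture_probability e mu e01.
have P1 : P [set x : R | x < 1] = 0%E by rewrite PE mixture_lt1.
rewrite -PE (GbarE _ _ P1) intP; [|exact: measurable_survival|by move=> x; rewrite lee_fin expR_ge0].
by rewrite ln1 oppr0 expR0 mulr1 (expRN_ln _ _ mu1).
Qed.

Lemma risk_mixture_le_worst q p eta mu : 0 < p -> 1 < mu -> 0 <= eps_of p eta mu <= 1 ->
  (risk q (mixture (eps_of p eta mu) mu) <= worst_risk q p eta)%E.
Proof.
move=> p0 mu1 e01; have [P PE intP] := mixture_probability _ mu e01.
apply: ereal_sup_ubound; exists P; last by rewrite PE.
split; first by rewrite PE mixture_lt1// ltW.
rewrite /moment intP; last 2 first.
- apply/measurable_EFinP; apply: (measurableT_comp (@measurable_powR R p)).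
  exact: measurable_ln.
- by move=> x; rewrite lee_fin powR_ge0.
rewrite ln1 powR0 ?gt_eqF// mule0 add0e lee_fin /eps_of.
by rewrite divfK// gt_eqF// powR_gt0// ln_gt0.
Qed.

(* [condrisk] is bounded below by a two-valued measurable function, which suffices for a law
   supported by two points. *)
Lemma risk_mixture_ge q e mu (a b : R) : 0 <= e <= 1 -> 1 < mu -> 0 <= a -> 0 <= b ->
  (a%:E <= condrisk (Tq q (mixture e mu)) 1)%E ->
  (b%:E <= condrisk (Tq q (mixture e mu)) mu)%E ->
  (((1 - e) * a + e * b)%:E <= risk q (mixture e mu))%E.
Proof.
move=> e01 mu1 a0 b0 ha hb; have [P PE intP] := mixture_probability _ mu e01.
have P1 : P [set x : R | x < 1] = 0%E by rewrite PE mixture_lt1// ltW.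
pose g (x : R) := (a * \1_[set 1%R] x + b * \1_[set mu] x)%:E.
have mg : measurable_fun [set: R] g.
  by apply/measurable_EFinP; apply: measurable_funD; apply: measurable_funM => //;
    apply: measurable_indic; exact: measurable_set1.
have g0 x : (0 <= g x)%E by rewrite lee_fin addr_ge0// mulr_ge0.
have mu1' : (mu == 1) = false by rewrite gt_eqF.
have g1 : g 1 = a%:E.
  rewrite /g !indicE mem_set// memNset ?mulr1 ?mulr0 ?addr0//= => /esym/eqP.
  by rewrite mu1'.
have gmu : g mu = b%:E.
  rewrite /g !indicE [mu \in [set mu]]mem_set// memNset ?mulr1 ?mulr0 ?add0r//= => /eqP.
  by rewrite mu1'.
rewrite /risk -PE.
apply: (@le_trans _ _ (\int[P]_x g x)%E).
  by rewrite intP// g1 gmu.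
apply: (ge_integral_off_null _ _ _ P _ _ _ _ P1 mg g0).
  exact: measurable_lt1.
move=> x /negP; rewrite -leNgt => x1; rewrite PE.
have [->|xn1] := eqVneq x 1; first by rewrite g1.
have [->|xnmu] := eqVneq x mu; first by rewrite gmu.
rewrite /g !indicE !memNset ?mulr0 ?addr0; last 2 first.
- by move=> /= /eqP; apply/negP.
- by move=> /= /eqP; apply/negP.
by apply: condrisk_ge0; exact: lt_le_trans x1.
Qed.

(** The solution [t] of [(1 - e) exp(-t) + e exp(-t/mu) = exp(-t) / q]. *)
Definition mix_threshold q e mu : R := ln ((q^-1 - 1 + e) / e) / (1 - mu^-1).

Lemma mix_threshold_ge0 q e mu : 0 < q < 1 -> 0 < e -> 1 < mu -> 0 <= mix_threshold q e mu.
Proof.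
move=> /andP[q0 q1] e0 mu1; rewrite divr_ge0//; last first.
  by rewrite subr_ge0 invf_le1 ?ltW// (lt_trans ltr01).
by rewrite ln_ge0// ler_pdivlMr// mul1r lerDr subr_ge0 invf_ge1 ?ltW.
Qed.

Lemma mix_threshold_eq q e mu : 0 < q < 1 -> 0 < e -> 1 < mu ->
  (q^-1 - 1 + e) * expR (- mix_threshold q e mu) =
  e * expR (- (mix_threshold q e mu / mu)).
Proof.
move=> /andP[q0 q1] e0 mu1; have mu0 : 0 < mu by exact: lt_trans mu1.
have k0 : 0 < 1 - mu^-1 by rewrite subr_gt0 invf_lt1.
have w0 : 0 < q^-1 - 1 + e by rewrite addr_gt0// subr_gt0 invf_gt1.
set t := mix_threshold q e mu.
have tE : expR (t * (1 - mu^-1)) = (q^-1 - 1 + e) / e.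
  by rewrite /t /mix_threshold divfK ?gt_eqF// lnK// posrE divr_gt0.
have -> : - (t / mu) = t * (1 - mu^-1) + - t by ring.
by rewrite expRD tE mulrA [e * _]mulrC divfK// gt_eqF.
Qed.

(** Multiplied by [exp s], the constraint at [s] reads [exp(s (1 - 1/mu)) >= (1/q - 1 + e) / e],
    whose left side increases with [s]. *)
Lemma Tq_mixture q e mu : 0 < q < 1 -> 0 < e <= 1 -> 1 < mu ->
  Tq q (mixture e mu) = (mix_threshold q e mu)%:E.
Proof.
move=> q01 /andP[e0 e1] mu1; have /andP[q0 q1] := q01.
have mu0 : 0 < mu by exact: lt_trans mu1.
have e01 : 0 <= e <= 1 by rewrite (ltW e0).
have k0 : 0 < 1 - mu^-1 by rewrite subr_gt0 invf_lt1.
have w0 : 0 < q^-1 - 1 + e by rewrite addr_gt0// subr_gt0 invf_gt1.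
set t := mix_threshold q e mu.
have t0 : 0 <= t by exact: mix_threshold_ge0.
have tE := mix_threshold_eq _ _ _ q01 e0 mu1.
apply/eqP; rewrite eq_le; apply/andP; split.
  apply: ereal_inf_lbound; exists t => //; split=> //.
  rewrite Gbar_mixture ?(ltW mu1)// lee_fin /Ebar.
  by move: tE; rewrite -/t; lra.
apply: le_ereal_inf_tmp => _ [s [s0 hs] <-]; rewrite lee_fin.
move: hs; rewrite Gbar_mixture ?(ltW mu1)// lee_fin /Ebar => hs.
rewrite /t /mix_threshold ler_pdivrMr// -[leRHS]expRK ler_ln ?posrE ?expR_gt0 ?divr_gt0//.
rewrite ler_pdivrMr// -(ler_pM2r (expR_gt0 (- s))).
have -> : expR (s * (1 - mu^-1)) * e * expR (- s) = e * expR (- (s / mu)).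
  by rewrite mulrAC -expRD [RHS]mulrC; congr (expR _ * _); ring.
lra.
Qed.

(** The equation of the threshold turns the null tail [exp(-t)] into a multiple of [c], putting
    variance and bias on the same scale [e]. *)
Lemma risk_mixture_ge_threshold q e mu t c : 0 < q < 1 -> 0 < e <= 1 -> 1 < mu ->
  t = mix_threshold q e mu -> c = expR (- (t / mu)) -> 1 <= t ->
  (((1 - e) * (ln t ^+ 2 * (e * c / (q^-1 - 1 + e))) + e * (ln mu ^+ 2 * (1 - c)))%:E
     <= risk q (mixture e mu))%E.
Proof.
move=> q01 e01 mu1 tE cE t1; rewrite cE; have /andP[e0 e1] := e01; have /andP[q0 q1] := q01.
have mu0 : 0 < mu by exact: lt_trans mu1.
have w0 : 0 < q^-1 - 1 + e by rewrite addr_gt0// subr_gt0 invf_gt1.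
have t0 : 0 < t by exact: lt_le_trans t1.
have -> : e * expR (- (t / mu)) / (q^-1 - 1 + e) = expR (- t).
  by rewrite tE -(mix_threshold_eq _ _ _ q01 e0 mu1) [X in X / _]mulrC mulfK// gt_eqF.
have TE := Tq_mixture _ _ _ q01 e01 mu1.
apply: risk_mixture_ge; rewrite ?(ltW e0)//.
- by rewrite mulr_ge0 ?sqr_ge0 ?expR_ge0.
- by rewrite mulr_ge0 ?sqr_ge0// subr_ge0 expR_le1 oppr_le0 divr_ge0 ?(ltW t0) ?(ltW mu0).
- by rewrite TE -tE; exact: condrisk1_ge_variance.
- by rewrite TE -tE; exact: condrisk_ge_bias.
Qed.

Lemma false_true_balance q d c : 0 < q < 1 -> 0 <= d <= 1 -> 0 <= c <= 1 ->
  (q < 2^-1 -> c <= d) -> (2^-1 < q -> 1 - d <= c) ->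
  (1 - d) * Lconst q <= q / (1 - q) * c + (1 - c).
Proof.
move=> /andP[q0 q1] /andP[d0 d1] /andP[c0 c1] hb hv.
have r0 : 0 <= q / (1 - q) by apply: divr_ge0; rewrite ?subr_ge0 ltW.
have rc0 : 0 <= q / (1 - q) * c by rewrite mulr_ge0.
rewrite /Lconst; case: ifPn => [|]; last first.
  rewrite -ltNge => /hv h; rewrite mulrC.
  have : q / (1 - q) * (1 - d) <= q / (1 - q) * c by rewrite ler_wpM2l.
  lra.
rewrite mulr1 le_eqVlt => /orP[/eqP qE|/hb h]; last by lra.
have -> : q / (1 - q) = 1 by rewrite qE; field.
lra.
Qed.

(** To be used with [T = ln t] and [L = ln mu]. Of the five factors [1 - d], two come from the
    logarithms, two from comparing [(1 - e) / (1/q - 1 + e)] with [q / (1 - q)], and one from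
    [false_true_balance]. *)
Lemma mixture_gain q d e c l (T L : R) : 0 < q < 1 -> 0 <= d <= 1 -> 0 <= c <= 1 ->
  0 <= e <= d * (1 - q) -> 0 <= l -> (1 - d) * l <= T -> (1 - d) * l <= L ->
  (q < 2^-1 -> c <= d) -> (2^-1 < q -> 1 - d <= c) ->
  e * ((1 - d) ^+ 5 * Lconst q * l ^+ 2) <=
  (1 - e) * (T ^+ 2 * (e * c / (q^-1 - 1 + e))) + e * (L ^+ 2 * (1 - c)).
Proof.
move=> q01 d01 c01 /andP[e0 ed] l0 hT hL hb hv.
have bal := false_true_balance _ _ _ q01 d01 c01 hb hv.
have /andP[q0 q1] := q01; have /andP[d0 d1] := d01; have /andP[c0 c1] := c01.
have q10 : 0 < 1 - q by rewrite subr_gt0.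
have w0 : 0 < q^-1 - 1 + e by rewrite ltr_wpDr// subr_gt0 invf_gt1.
have e_d : e <= d by rewrite (le_trans ed)// ler_piMr//; lra.
have d10 : 0 <= 1 - d by rewrite subr_ge0.
have dl0 : 0 <= (1 - d) * l by rewrite mulr_ge0.
have T2 : ((1 - d) * l) ^+ 2 <= T ^+ 2 by rewrite lerXn2r// nnegrE (le_trans dl0).
have L2 : ((1 - d) * l) ^+ 2 <= L ^+ 2 by rewrite lerXn2r// nnegrE (le_trans dl0).
have rho : (1 - d) ^+ 2 * (q / (1 - q)) <= (1 - e) / (q^-1 - 1 + e).
  rewrite ler_pdivlMr//.
  have -> : (1 - d) ^+ 2 * (q / (1 - q)) * (q^-1 - 1 + e) =
    (1 - d) ^+ 2 * (1 + e * q / (1 - q)) by field; rewrite !gt_eqF.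
  have : e * q / (1 - q) <= d.
    by rewrite ler_pdivrMr// (le_trans _ ed)// ler_piMr// ltW.
  set z := _ / _ => zd.
  have : (1 - d) * (1 + z) <= 1 by nra.
  have -> : (1 - d) ^+ 2 * (1 + z) = (1 - d) * ((1 - d) * (1 + z)) by ring.
  move=> h; apply: (@le_trans _ _ (1 - d)); last by rewrite lerD2l lerN2.
  by rewrite -[leRHS]mulr1 ler_wpM2l.
have d2 : (1 - d) ^+ 2 <= 1 by rewrite exprn_ile1// lerBlDr lerDl.
have d20 : 0 <= (1 - d) ^+ 2 by rewrite sqr_ge0.
have key : (1 - d) ^+ 3 * Lconst q <= (1 - e) / (q^-1 - 1 + e) * c + (1 - c).
  apply: (@le_trans _ _ ((1 - d) ^+ 2 * (q / (1 - q) * c + (1 - c)))).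
    by rewrite exprSr -mulrA ler_wpM2l.
  rewrite mulrDr lerD//; first by rewrite mulrA ler_wpM2r.
  by rewrite ler_piMl// subr_ge0.
have v0 : 0 <= (1 - e) / (q^-1 - 1 + e).
  by rewrite divr_ge0 ?(ltW w0)// subr_ge0 (le_trans e_d).
rewrite [leRHS](_ : _ = e * (T ^+ 2 * ((1 - e) / (q^-1 - 1 + e) * c) + L ^+ 2 * (1 - c))); last by ring.
rewrite ler_wpM2l//.
apply: (@le_trans _ _ (((1 - d) * l) ^+ 2 * ((1 - e) / (q^-1 - 1 + e) * c + (1 - c)))).
  rewrite (_ : _ * l ^+ 2 = ((1 - d) * l) ^+ 2 * ((1 - d) ^+ 3 * Lconst q)); last by ring.
  by rewrite ler_wpM2l ?sqr_ge0.
by rewrite mulrDr lerD// ler_wpM2r// ?subr_ge0// mulr_ge0.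
Qed.

End two_point_mixture.

(** * Asymptotics *)

Section least_favorable_mixture.
Variable R : realType.
Implicit Types (q p e mu t d c l x s eta : R).

Lemma ln_le_scale d l : 0 < d -> 2 / d ^+ 2 <= l -> ln l <= d * l.
Proof.
move=> d0; rewrite ler_pdivrMr ?exprn_gt0// => h.
have l0 : 0 < l by rewrite -(pmulr_lgt0 _ (exprn_gt0 2 d0)); apply: lt_le_trans h.
have dl : 0 <= d * l by rewrite mulr_ge0 ?ltW.
rewrite -[leRHS]expRK ler_ln ?posrE ?expR_gt0//.
apply: le_trans (expR_ge_pow _ _ 1 dl); rewrite (_ : 2`!%:R = 2)//.
rewrite ler_pdivlMr// exprMn expr2 mulrA [l * 2]mulrC ler_wpM2r ?(ltW l0)//.
by rewrite mulrC in h.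
Qed.

Lemma mu_tilde_bounds q s eta : 0 <= s <= 1 -> 0 < ln eta^-1 -> 1 <= ln (ln eta^-1) ->
  mu_b eta <= mu_tilde q s eta <= mu_v eta.
Proof.
move=> /andP[s0 s1] x0 l1.
have l0 : 0 < ln (ln eta^-1) by exact: lt_le_trans l1.
have bv : mu_b eta <= mu_v eta.
  rewrite /mu_b /mu_v ler_wpM2l ?(ltW x0)// (le_trans _ l1)//.
  by rewrite invf_le1.
rewrite /mu_tilde; case: ifPn => _; first by rewrite lexx.
case: ifPn => _; first by rewrite lexx andbT.
move: bv; set b := mu_b _; set v := mu_v _ => bv.
by apply/andP; split; nra.
Qed.

Lemma ln_mu_bounds d x mu : 0 < x -> 0 < ln x -> ln (ln x) <= d * ln x ->
  x / ln x <= mu <= x * ln x -> (1 - d) * ln x <= ln mu <= (1 + d) * ln x.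
Proof.
move=> x0 l0 hl /andP[h1 h2].
have b0 : 0 < x / ln x by rewrite divr_gt0.
have mu0 : 0 < mu by exact: lt_le_trans h1.
move: h1 h2; rewrite -ler_ln ?posrE// -[mu <= _]ler_ln ?posrE// ?mulr_gt0//.
rewrite ln_div ?posrE// lnM ?posrE// => h1 h2.
by apply/andP; split; lra.
Qed.

Lemma ln_eps_of p eta mu : 0 < eta -> 0 < ln mu ->
  ln (eps_of p eta mu)^-1 = p * ln eta^-1 + p * ln (ln mu).
Proof.
move=> eta0 L0; rewrite /eps_of invf_div ln_div ?posrE ?powR_gt0//.
by rewrite !ln_powR lnV ?posrE//; ring.
Qed.

Lemma eps_of_le p eta mu : 0 < p -> 1 < eta^-1 -> 1 <= ln mu ->
  eps_of p eta mu <= (p * ln eta^-1)^-1.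
Proof.
move=> p0 eta1 L1; have eta0 : 0 < eta by rewrite -invr_gt0 (lt_trans ltr01).
have x0 : 0 < ln eta^-1 by rewrite ln_gt0.
have Lp := powR_ge1 _ _ _ (ltW p0) L1.
apply: (@le_trans _ _ (eta `^ p)).
  by rewrite ler_pdivrMr ?(lt_le_trans ltr01)// ler_peMr// powR_ge0.
rewrite ln_powR_expR// expRN lef_pV2 ?posrE ?expR_gt0 ?mulr_gt0//.
by apply: le_trans (expR_ge1Dx _); rewrite lerDr.
Qed.

Lemma mix_threshold_lower q e mu : 0 < q < 1 -> 0 < e -> 1 < mu ->
  ln (q^-1 - 1) + ln e^-1 <= mix_threshold R q e mu.
Proof.
move=> /andP[q0 q1] e0 mu1; have mu0 : 0 < mu by exact: lt_trans mu1.
have w0 : 0 < q^-1 - 1 by rewrite subr_gt0 invf_gt1.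
have k0 : 0 < 1 - mu^-1 by rewrite subr_gt0 invf_lt1.
have N0 : 0 <= ln ((q^-1 - 1 + e) / e).
  by rewrite ln_ge0// ler_pdivlMr// mul1r lerDr ltW.
apply: (@le_trans _ _ (ln ((q^-1 - 1 + e) / e))).
  have w1 : 0 < q^-1 - 1 + e by exact: addr_gt0.
  rewrite -lnM ?posrE ?invr_gt0// ler_ln ?posrE ?(divr_gt0 w0) ?(divr_gt0 w1)//.
  by rewrite ler_wpM2r ?invr_ge0 ?(ltW e0)// lerDl ltW.
by rewrite /mix_threshold ler_pdivlMr// ler_piMr// lerBlDr lerDl invr_ge0 ltW.
Qed.

Lemma mix_threshold_upper q e mu : 0 < q < 1 -> 0 < e <= 1 -> 2 <= mu ->
  mix_threshold R q e mu <= 2 * (ln q^-1 + ln e^-1).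
Proof.
move=> /andP[q0 q1] /andP[e0 e1] mu2; have mu0 : 0 < mu by exact: lt_le_trans mu2.
have w0 : 0 < q^-1 - 1 by rewrite subr_gt0 invf_gt1.
have mu12 : mu^-1 <= 2^-1 by rewrite lef_pV2 ?posrE.
have k0 : 0 < 1 - mu^-1 by lra.
have N0 : 0 <= ln ((q^-1 - 1 + e) / e).
  by rewrite ln_ge0// ler_pdivlMr// mul1r lerDr ltW.
have NE : ln ((q^-1 - 1 + e) / e) <= ln q^-1 + ln e^-1.
  have w1 : 0 < q^-1 - 1 + e by exact: addr_gt0.
  have q'0 : 0 < q^-1 by rewrite invr_gt0.
  rewrite -lnM ?posrE ?invr_gt0// ler_ln ?posrE ?(divr_gt0 q'0) ?(divr_gt0 w1)//.
  by rewrite ler_wpM2r ?invr_ge0 ?(ltW e0)//; lra.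
rewrite /mix_threshold ler_pdivrMr//.
move: NE N0 mu12; set N := ln (_ / e); set S := _ + ln e^-1; set v := mu^-1; nra.
Qed.

(** The threshold is of order [x = ln(1/eta)]. For the mean [x / l] the ratio [t / mu] is at least
    [(p/2) l], so [c] is small; for the mean [x l] it is [O(1/l)], so [c] is close to 1. The bound
    on [l] is uniform in [s]. *)
Lemma mixture_regime q p d : 0 < q < 1 -> 0 < p < 2 -> 0 < d <= 2^-1 ->
  exists2 l0 : R, 0 < l0 & forall s eta mu e t l, 0 <= s <= 1 -> 0 < eta ->
    l = ln (ln eta^-1) -> mu = mu_tilde q s eta -> e = eps_of p eta mu ->
    t = mix_threshold R q e mu -> l0 <= l ->
    [/\ 1 < mu, 0 < e <= d * (1 - q), (1 - d) * l <= ln mu & ln mu <= (1 + d) * l] /\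
    [/\ 1 <= t, (1 - d) * l <= ln t, q < 2^-1 -> expR (- (t / mu)) <= d
      & 2^-1 < q -> 1 - d <= expR (- (t / mu))].
Proof.
move=> q01 pp /andP[d0 d2]; have /andP[q0 q1] := q01; have /andP[p0 p2] := pp.
have q10 : 0 < 1 - q by rewrite subr_gt0.
pose K := ln (q^-1 - 1); pose K' := ln q^-1.
have K'0 : 0 <= K' by rewrite ln_ge0// invf_ge1 ?ltW.
(* In order, these give [ln mu >= 1], [ln l <= d l], [e <= d (1 - q)], [-K <= (p/2) x],
   [ln (p/2) >= - d l], [c <= d] in the bias regime and [t / mu <= d] in the variance regime. *)
have [l0 [_ hl0]] : \forall l \near +oo,
    [/\ 2 <= l, 2 / d ^+ 2 <= l & (p * (d * (1 - q)))^-1 <= l] /\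
    [/\ - K / (p / 2) <= l, - ln (p / 2) / d <= l, (d * (p / 2))^-1 <= l
      & 2 * (K' + 3 * p) / d <= l].
  by near=> l; split; split; near: l; apply: nbhs_pinfty_ge; rewrite num_real.
exists (`|l0| + 1); first by rewrite ltr_wpDl.
move=> s eta mu e t l s01 eta0 lE muE eE tE ll.
have {hl0 ll} [[l2 ld leps] [lK lp lb lv]] := hl0 l (lt_le_trans (le_lt_trans (ler_norm l0) (ltr_pwDr ltr01 (lexx _))) ll).
set x := ln eta^-1 in lE.
have l1 : 1 <= l by lra.
have lgt0 : 0 < l by exact: lt_le_trans l1.
have x1 : 1 < x.
  by rewrite ltNge; apply/negP => /ln_le0; rewrite -lE leNgt lgt0.
have x0 : 0 < x by exact: lt_trans x1.
have lx : l <= x by rewrite lE ltW// ln_sublinear.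
have mub : x / l <= mu <= x * l.
  by have := mu_tilde_bounds q s eta s01 x0; rewrite -/x -lE -muE /mu_b /mu_v -/x -lE; apply.
have lnl := ln_le_scale _ _ d0 ld.
have /andP[L1 L2] : (1 - d) * l <= ln mu <= (1 + d) * l.
  by rewrite lE; apply: ln_mu_bounds; rewrite -?lE.
have Lge1 : 1 <= ln mu by apply: le_trans L1; nra.
have mu0 : 0 < mu by have /andP[h _] := mub; apply: lt_le_trans h; rewrite divr_gt0.
have mu2 : 2 <= mu.
  by rewrite -[mu]lnK ?posrE//; have := expR_ge1Dx (ln mu); lra.
have mu1 : 1 < mu by lra.
have Lgt0 : 0 < ln mu by exact: lt_le_trans Lge1.
have e0 : 0 < e by rewrite eE divr_gt0 ?powR_gt0.
have eta1 : 1 < eta^-1.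
  rewrite ltNge; apply/negP => /ln_le0; rewrite -/x => x00.
  by have := lt_le_trans x0 x00; rewrite ltxx.
have ed : e <= d * (1 - q).
  rewrite eE (le_trans (eps_of_le _ _ _ p0 eta1 Lge1))// -/x.
  rewrite -[leRHS]invrK lef_pV2 ?posrE ?mulr_gt0 ?invr_gt0 ?mulr_gt0//.
  have pd0 : 0 < d * (1 - q) by rewrite mulr_gt0.
  rewrite -(ler_pM2l (p0 : 0 < p)) ?invr_gt0// in leps *.
  move: leps; rewrite invfM mulrA divff ?gt_eqF// mul1r => /le_trans; apply.
  by rewrite ler_wpM2l// ltW.
have e1 : e <= 1 by rewrite (le_trans ed)// mulr_ile1//; lra.
have lne : ln e^-1 = p * x + p * ln (ln mu) by rewrite eE ln_eps_of.
have t_lower : p / 2 * x <= t.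
  rewrite tE (le_trans _ (mix_threshold_lower _ _ _ q01 e0 mu1))// lne -/K.
  have : 0 <= p * ln (ln mu) by rewrite mulr_ge0 ?ln_ge0// ltW.
  have : - K <= p / 2 * x.
    have p20 : 0 < p / 2 by rewrite divr_gt0.
    move: lK; rewrite ler_pdivrMr// => /le_trans; apply.
    by rewrite mulrC ler_wpM2l// ltW.
  lra.
have px0 : 0 < p / 2 * x by rewrite mulr_gt0// divr_gt0.
have t0 : 0 < t by exact: lt_le_trans t_lower.
have lnt : (1 - d) * l <= ln t.
  apply: (@le_trans _ _ (ln (p / 2 * x))); last by rewrite ler_ln ?posrE.
  rewrite lnM ?posrE ?divr_gt0// -lE.
  by move: lp; rewrite ler_pdivrMr//; lra.
have t1 : 1 <= t.
  rewrite leNgt; apply/negP => /ltW/ln_le0 h.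
  have := le_trans lnt h; nra.
split; first by rewrite e0 ed.
split=> // hq.
- have muE' : mu = x / l by rewrite muE /mu_tilde hq /mu_b -/x -lE.
  have h : p / 2 * l <= t / mu.
    rewrite ler_pdivlMr// muE' mulrA [p / 2 * l * x]mulrAC mulfK ?gt_eqF//.
  rewrite expRN invf_ple ?posrE ?expR_gt0//.
  apply: le_trans (expR_ge1Dx _).
  have : d^-1 <= p / 2 * l.
    by move: lb; rewrite invfM mulrC ler_pdivrMl ?divr_gt0// mulrC.
  lra.
- have muE' : mu = x * l.
    by rewrite muE /mu_tilde ltNge (ltW hq)/= hq /mu_v -/x -lE.
  have h : t / mu <= d.
    rewrite ler_pdivrMr// tE.
    rewrite (le_trans (mix_threshold_upper _ _ _ q01 _ mu2)) ?e0//.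
    rewrite lne -/K' [X in _ <= d * X]muE'.
    have lnL : ln (ln mu) <= 2 * x.
      have h1 := ln_sublinear Lgt0.
      have h2 : (1 + d) * l <= 2 * x.
        by apply: ler_pM => //; lra.
      lra.
    have pL : p * ln (ln mu) <= p * (2 * x) by rewrite ler_wpM2l// ltW.
    have K'x : K' <= K' * x by rewrite ler_peMr// ltW.
    have : 2 * (K' + 3 * p) * x <= d * l * x.
      by move: lv; rewrite ler_pdivrMr// [l * d]mulrC => h1; rewrite ler_wpM2r// ltW.
    lra.
  by have := expR_ge1Dx (- (t / mu)); lra.
Unshelve. all: by end_near.
Qed.

Lemma bernoulli_le d n : 0 <= d <= 1 -> 1 - n%:R * d <= (1 - d) ^+ n.
Proof.
move=> /andP[d0 d1]; elim: n => [|n ih]; first by rewrite mul0r subr0 expr0.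
rewrite exprS -natr1.
have : (1 - d) * (1 - n%:R * d) <= (1 - d) * (1 - d) ^+ n by rewrite ler_wpM2l// subr_ge0.
have : 0 <= n%:R * (d * d) by rewrite mulr_ge0// mulr_ge0.
lra.
Qed.

Lemma risk_mixture_asymptotic_ge q p k : 0 < q < 1 -> 0 < p < 2 -> 0 < k ->
  exists2 l0 : R, 0 < l0 & forall s eta mu, 0 <= s <= 1 -> 0 < eta ->
    mu = mu_tilde q s eta -> l0 <= ln (ln eta^-1) ->
    (((1 - k) * Lconst q * rate p eta)%:E <= risk q (mixture (eps_of p eta mu) mu))%E /\
    (risk q (mixture (eps_of p eta mu) mu) <= worst_risk q p eta)%E.
Proof.
move=> q01 pp k0; have /andP[q0 q1] := q01; have /andP[p0 p2] := pp.
(* Five factors [1 - d] come from [mixture_gain] and two from replacing [ln mu] by [l] in [eps_of];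
   Bernoulli's inequality turns the seventh power into [1 - 7d]. *)
pose d := Num.min 2^-1 (k / 7).
have d0 : 0 < d by rewrite lt_min invr_gt0 divr_gt0// ltr0n.
have d2 : d <= 2^-1 by rewrite ge_min lexx.
have dk : 7 * d <= k.
  have : d <= k / 7 by rewrite ge_min lexx orbT.
  lra.
clearbody d; have d02 : 0 < d <= 2^-1 by rewrite d0.
have [l0 l00 hl0] := mixture_regime _ _ _ q01 pp d02; exists l0 => // s eta mu s01 eta0 muE hl.
set e := eps_of p eta mu; set l := ln (ln eta^-1) in hl *.
have [[mu1 /andP[e0 ed] L1 L2] [t1 lt cb cv]] :=
  hl0 s eta mu e _ l s01 eta0 erefl muE erefl erefl hl.
have d01 : 0 <= d <= 1 by rewrite (ltW d0) (le_trans d2)// invf_le1// ler1n.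
have e1 : e <= 1.
  by rewrite (le_trans ed)// mulr_ile1// ?(ltW d0)//; have /andP[_] := d01; lra.
split; last first.
  by apply: risk_mixture_le_worst => //; rewrite (ltW e0).
have e01 : 0 < e <= 1 by rewrite e0.
apply: le_trans (risk_mixture_ge_threshold _ _ _ _ _ _ q01 e01 mu1 erefl erefl t1).
set t := mix_threshold _ _ _ _ in t1 lt cb cv *; set c := expR _ in cb cv *.
have lgt0 : 0 < l by exact: lt_le_trans hl.
have mu0 : 0 < mu by exact: lt_trans mu1.
have c01 : 0 <= c <= 1.
  by rewrite expR_ge0 expR_le1 oppr_le0 divr_ge0 ?(ltW mu0)// (le_trans ler01).
have e_d : 0 <= e <= d * (1 - q) by rewrite (ltW e0).
have := mixture_gain _ _ _ _ _ _ _ _ q01 d01 c01 e_d (ltW lgt0) lt L1 cb cv.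
rewrite lee_fin => /(le_trans _); apply.
have Lp0 : 0 < ln mu `^ p by rewrite powR_gt0// ln_gt0.
have Llp : ln mu `^ p <= (1 + d) ^+ 2 * l `^ p.
  apply: powR_le_sqr_mul; rewrite ?(ltW lgt0)//.
  - by rewrite (ltW p0) (ltW p2).
  - by rewrite lerDl ltW.
  - by rewrite ln_ge0// ltW.
have lc := Lconst_ge1 _ _ q1.
have n0 : 0 < eta `^ p by rewrite powR_gt0.
have l2p0 : 0 < l `^ (2 - p) by rewrite powR_gt0.
have el : (1 - d) ^+ 2 * (eta `^ p * l `^ (2 - p)) <= e * l ^+ 2.
  rewrite /e /eps_of [leRHS]mulrAC ler_pdivlMr// (sqr_powR_split _ p)// ?(ltW lgt0)//.
  apply: (@le_trans _ _ ((1 - d) ^+ 2 * (eta `^ p * l `^ (2 - p)) * ((1 + d) ^+ 2 * l `^ p))).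
    by rewrite ler_wpM2l// mulr_ge0 ?sqr_ge0// mulr_ge0// ltW.
  rewrite [leLHS](_ : _ = ((1 - d) * (1 + d)) ^+ 2 * (eta `^ p * (l `^ p * l `^ (2 - p)))); last by ring.
  have /andP[_ d1] := d01.
  rewrite ler_piMl//; first by rewrite mulr_ge0 ?(ltW n0)// mulr_ge0// ?powR_ge0.
  by apply: exprn_ile1; nra.
rewrite [leRHS](_ : _ = (1 - d) ^+ 5 * Lconst q * (e * l ^+ 2)); last by ring.
have d10 : 0 <= (1 - d) ^+ 5 by rewrite exprn_ge0// subr_ge0; have /andP[] := d01.
apply: (@le_trans _ _ ((1 - d) ^+ 5 * Lconst q * ((1 - d) ^+ 2 * (eta `^ p * l `^ (2 - p))))).
  rewrite [leRHS](_ : _ = (1 - d) ^+ 7 * (Lconst q * (eta `^ p * l `^ (2 - p)))); last by ring.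
  rewrite /rate -/l -mulrA ler_wpM2r//.
    by apply: mulr_ge0; [exact: le_trans lc|apply: mulr_ge0; exact: ltW].
  have := bernoulli_le _ 7 d01; lra.
by rewrite ler_wpM2l// mulr_ge0// (le_trans ler01).
Qed.

End least_favorable_mixture.

(** * Passage to the limit *)

Lemma near_loglog_ge (R : realType) (l0 : R) :
  \forall eta \near (0 : R)^'+, 0 < eta /\ l0 <= ln (ln eta^-1).
Proof.
near=> eta; have eta0 : 0 < eta by near: eta; exact: nbhs_right_gt.
split=> //.
have h : eta < expR (- expR l0) by near: eta; apply: nbhs_right_lt; exact: expR_gt0.
have lx : expR l0 <= ln eta^-1.
  by rewrite lnV ?posrE// lerNr -[leRHS]expRK ler_ln ?posrE ?expR_gt0// ltW.
rewrite -[leLHS]expRK ler_ln ?posrE ?expR_gt0//.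
by apply: lt_le_trans lx; exact: expR_gt0.
Unshelve. all: by end_near.
Qed.

(** Both extended-real risks are caught between finite bounds, hence real, and both limits follow
    from this one chain of inequalities. *)
Lemma near_risk_sandwich (R : realType) (q p k : R) : 0 < q < 1 -> 0 < p < 2 -> 0 < k ->
  \forall eta \near (0 : R)^'+, forall s, 0 <= s <= 1 ->
    exists r w : R, [/\ 0 < rate p eta,
      risk q (mixture (eps_of p eta (mu_tilde q s eta)) (mu_tilde q s eta)) = r%:E,
      worst_risk q p eta = w%:E &
      (1 - k) * Lconst q * rate p eta <= r <= w /\ w <= (1 + k) * Lconst q * rate p eta].
Proof.
move=> q01 pp k0.
have [l1 l10 h1] := worst_risk_asymptotic_le _ _ _ _ q01 pp k0.
have [l2 l20 h2] := risk_mixture_asymptotic_ge _ _ _ _ q01 pp k0.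
apply: filterS2 (near_loglog_ge _ l1) (near_loglog_ge _ l2) => eta [eta0 hl1] [_ hl2] s s01.
have [lo up] := h2 s eta _ s01 eta0 erefl hl2.
have wo := h1 _ eta0 hl1.
have rate0 : 0 < rate p eta.
  by rewrite mulr_gt0// powR_gt0//; exact: lt_le_trans hl1.
move: lo up wo; set r := risk _ _; set w := worst_risk _ _ _ => lo up wo.
case: w up wo => [w| |] up wo; last 2 first.
- by move: wo; rewrite leye_eq.
- by move: (le_trans lo up); rewrite leeNy_eq.
case: r lo up => [r| |] lo up; last 2 first.
- by move: up; rewrite leye_eq.
- by move: lo; rewrite leeNy_eq.
exists r, w; split=> //; split; last by rewrite -lee_fin.
by rewrite -!lee_fin lo.
Qed.

Theorem theorem5p1 (R : realType) (q p : R) :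
  0 < q < 1 -> 0 < p < 2 ->
  ((fun eta : R => (worst_risk q p eta * ((rate p eta)^-1)%:E)%E)
     @ 0^'+ --> (Lconst q)%:E)
  /\
  (forall s : R, 0 <= s <= 1 ->
     (fun eta : R =>
        (risk q (mixture (eps_of p eta (mu_tilde q s eta)) (mu_tilde q s eta))
         / worst_risk q p eta)%E)
     @ 0^'+ --> 1%:E).
Proof.
move=> q01 pp; have /andP[q0 q1] := q01.
have L1 := Lconst_ge1 _ _ q1.
have Lgt0 : 0 < Lconst q by exact: lt_le_trans L1.
split=> [|s s01]; apply/fine_cvgP; split.
(* The worst-case risk does not involve [s]; any admissible value provides the lower bound. *)
- have s0 : 0 <= (0 : R) <= 1 by rewrite lexx ler01.
  apply: filterS (near_risk_sandwich _ _ _ _ q01 pp ltr01) => eta /(_ _ s0).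
  by move=> [r [w [_ _ -> _]]].
- have s0 : 0 <= (0 : R) <= 1 by rewrite lexx ler01.
  apply/cvgrPdist_le => e e0; pose k := e / Lconst q.
  have k0 : 0 < k by rewrite divr_gt0.
  apply: filterS (near_risk_sandwich _ _ _ _ q01 pp k0) => eta /(_ _ s0).
  move=> [r [w [r0 _ /= -> [/andP[h1 h2] h3]]]]; rewrite -EFinM /=.
  have kL : k * Lconst q = e by rewrite /k divfK// gt_eqF.
  rewrite ler_distlC ler_pdivrMr// ler_pdivlMr//.
  apply/andP; split; first by apply: le_trans h2; move: h1; rewrite mulrBl kL mul1r.
  by move: h3; rewrite mulrDl kL mul1r.
- have k0 : 0 < 2^-1 :> R by rewrite invr_gt0.
  apply: filterS (near_risk_sandwich _ _ _ _ q01 pp k0) => eta /(_ _ s01).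
  move=> [r [w [r0 -> -> [/andP[h1 h2] h3]]]].
  have w0 : 0 < w by apply: lt_le_trans (le_trans h1 h2); rewrite mulr_gt0// mulr_gt0//; lra.
  by rewrite inver gt_eqF.
(* The ratio lies between [(1 - k) / (1 + k) >= 1 - 2k >= 1 - e] and 1; [k <= 1/2] keeps the
   denominator positive. *)
- apply/cvgrPdist_le => e e0; pose k := Num.min 2^-1 (e / 4).
  have k0 : 0 < k by rewrite lt_min invr_gt0 divr_gt0// ltr0n.
  have k2 : k <= 2^-1 by rewrite ge_min lexx.
  have ke : 4 * k <= e.
    have : k <= e / 4 by rewrite ge_min lexx orbT.
    lra.
  apply: filterS (near_risk_sandwich _ _ _ _ q01 pp k0) => eta /(_ _ s01).
  move=> [r [w [r0 /= -> -> [/andP[h1 h2] h3]]]].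
  have B0 : 0 < Lconst q * rate p eta by rewrite mulr_gt0.
  have w0 : 0 < w.
    by apply: lt_le_trans (le_trans h1 h2); rewrite mulr_gt0// mulr_gt0//; lra.
  rewrite inver gt_eqF// -EFinM /=.
  rewrite ler_distlC ler_pdivrMr// ler_pdivlMr//.
  move: h1 h3 B0; rewrite -!mulrA; set B := Lconst q * _ => h1 h3 B0.
  apply/andP; split; nra.
Qed.
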